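(* Let $s\geq 1$ be an integer and $R=k[x,y,z]$ with the standard grading, where $k$ is any field. Let $V_s^s$ be the $(2s+1)\times(2s+1)$ skew-symmetric matrix defined in the context. The ideal $$I:=(\mathrm{Pf}_j(V_s^s)\mid 1\leq j\leq 2s+1,\ j\neq s+1)+R_+\,\mathrm{Pf}_{s+1}(V_s^s)$$ is minimally generated by $2s+2$ elements and defines a compressed ring with $\operatorname{Soc}(R/I)\cong k(-s)\oplus k(-2s+1)$, and $R/I$ has graded Betti numbers given by a minimal free resolution of the form $$0\to R(-s-3)\oplus R(-2s-2)\to R(-s-1)^{s-1}\oplus R(-s-2)^{s+4}\to R(-s)^s\oplus R(-s-1)^{s+2}\to R .$$
   Context: $R_+=(x,y,z)$. Let $U_s^s$ be the $s\times s$ matrix with entries $(U_s^s)_{i,s-i}=x$, $(U_s^s)_{i,s-i+1}=z$, $(U_s^s)_{i,s-i+2}=y$ (whenever the indices lie between $1$ and $s$), and all other entries $0$. Set $$V_s^s=\begin{pmatrix} O & O_{x^2} & (U_s^s)^T\\ -(O_{x^2})^T & 0 & {}^{y}O\\ -U_s^s & -({}^{y}O)^T & O\end{pmatrix},$$ where $O$ is the $s\times s$ zero matrix, $O_{x^2}$ is the $s\times 1$ column with $x^2$ in its last entry and zeros elsewhere, and ${}^{y}O$ is the $1\times s$ row with $y$ in its first entry and zeros elsewhere. For an alternating matrix $M$, $\mathrm{Pf}_j(M)$ is the Pfaffian of the matrix obtained by deleting the $j$th row and column of $M$. The socle isomorphism is as graded vector spaces: one basis element in degree $s$ and one in degree $2s-1$.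 $R/I$ compressed means: with $c_\ell=\dim_k \operatorname{Soc}(R/I)_\ell$, $\dim_k (R/I)_i=\min\{\binom{2+i}{i},\ \sum_{\ell=0}^{2s-1} c_\ell\binom{2+\ell-i}{\ell-i}\}$ for $0\le i\le 2s-1$, where binomials with $\ell<i$ are $0$. *)

(* Defs.v *)
From HB Require Import structures.
From mathcomp Require Import all_boot all_order all_algebra.
From mathcomp Require Export mpoly.

Set Implicit Arguments.
Unset Strict Implicit.
Unset Printing Implicit Defensive.

Import GRing.Theory.
Local Open Scope ring_scope.

(* Expansion along the first row; meant for alternating matrices (only the
   entries above the diagonal are read).  The value is 0 for odd n. *)
Fixpoint pf (R : comNzRingType) (n : nat) : 'M[R]_n -> R :=
  match n return 'M[R]_n -> R with
  | 0 => fun=> 1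
  | 1 => fun=> 0
  | n'.+2 => fun A =>
      \sum_(j < n'.+1) (-1) ^+ j * A ord0 (lift ord0 j) *
        pf (row' j (col' j (row' ord0 (col' ord0 A))))
  end.

Definition pf_minor (R : comNzRingType) (n : nat) (A : 'M[R]_n) (j : 'I_n) : R :=
  pf (row' j (col' j A)).

Section Ideals.
Variable k : fieldType.
Local Notation R := {mpoly k[3]}.

Definition ideal_gen (G : R -> Prop) : R -> Prop := fun p =>
  exists (n : nat) (c g : 'I_n -> R),
    (forall i, G (g i)) /\ p = \sum_(i < n) c i * g i.

Definition ideal_add (I J : R -> Prop) : R -> Prop := fun p =>
  exists q r : R, [/\ I q, J r & p = q + r].

Definition ideal_mul_elt (I : R -> Prop) (f : R) : R -> Prop := fun p =>
  exists2 r : R, I r & p = r * f.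

Definition R_plus : R -> Prop := ideal_gen (fun p => exists i : 'I_3, p = 'X_i).

(* A minimal system of generators: homogeneous, and of the least possible
   cardinality among all generating families of I. *)
Definition minimally_generated (I : R -> Prop) (n : nat) : Prop :=
  (exists g : n.-tuple R,
     [/\ forall i : 'I_n, exists d : nat, tnth g i \is d.-homog
       & forall p, I p <-> ideal_gen (fun q => q \in g) p])
  /\ (forall h : seq R,
        (forall p, I p <-> ideal_gen (fun q => q \in h) p) -> (n <= size h)%N).

(* The residue classes of b form a k-basis of the image of P in R/I. *)
Definition is_basis_mod (P I : R -> Prop) (n : nat) (b : 'I_n -> R) : Prop :=
  [/\ forall j, P (b j),
      forall c : 'I_n -> k, I (\sum_(j < n) c j *: b j) -> forall j, c j = 0
    & forall p, P p -> exists c : 'I_n -> k, I (p - \sum_(j < n) c j *: b j)].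

(* dim_k (R/I)_d = n, for I homogeneous *)
Definition quot_dim (I : R -> Prop) (d n : nat) : Prop :=
  exists b : 'I_n -> R, is_basis_mod (fun p => p \is d.-homog) I b.

(* Soc(R/I) = socle_lift I / I *)
Definition socle_lift (I : R -> Prop) : R -> Prop := fun p =>
  forall r, R_plus r -> I (r * p).

(* dim_k Soc(R/I)_d = n, for I homogeneous *)
Definition socle_dim (I : R -> Prop) (d n : nat) : Prop :=
  exists b : 'I_n -> R,
    is_basis_mod (fun p => p \is d.-homog /\ socle_lift I p) I b.

(* Soc(R/I) is isomorphic to the direct sum of the k(-d), d in ds, as a graded
   vector space: it has a k-basis of homogeneous classes of degrees ds. *)
Definition socle_iso (I : R -> Prop) (ds : seq nat) : Prop :=
  exists2 b : 'I_(size ds) -> R,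
    is_basis_mod (socle_lift I) I b & forall j, b j \is (nth 0%N ds j).-homog.

(* R/I is compressed, with socle living in degrees at most t. *)
Definition compressed (I : R -> Prop) (t : nat) : Prop :=
  exists2 c : nat -> nat,
    forall l, (l <= t)%N -> socle_dim I l (c l)
  & forall i, (i <= t)%N ->
      quot_dim I i
        (minn 'C(2 + i, i)
              (\sum_(l < t.+1 | (i <= l)%N) c l * 'C(2 + (l - i), l - i))).

(* A graded free complex ... -> F_2 -> F_1 -> F_0 = R is encoded by the lists
   of shifts of F_1, F_2, ...: the list [:: a_1; ...; a_r] stands for
   R(-a_1) + ... + R(-a_r), and modules beyond the end of F are 0. *)
Definition shifts (F : seq (seq nat)) (i : nat) : seq nat :=
  nth [::] ([:: 0%N] :: F) i.

Definition free_rk (F : seq (seq nat)) (i : nat) : nat := size (shifts F i).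

(* Elements of F_i are row vectors; d i : F_(i+1) -> F_i acts by right
   multiplication.  An entry from R(-a) to R(-b) has degree a - b, hence
   vanishes when a < b. *)
Definition min_graded_resolution (I : R -> Prop) (F : seq (seq nat))
    (d : forall i : nat, 'M[R]_(free_rk F i.+1, free_rk F i)) : Prop :=
  [/\ forall (i : nat) (u : 'I_(free_rk F i.+1)) (v : 'I_(free_rk F i)),
        let a := nth 0%N (shifts F i.+1) u in
        let b := nth 0%N (shifts F i) v in
        ((b <= a)%N -> d i u v \is (a - b)%N.-homog) /\ ((a < b)%N -> d i u v = 0),
      forall p : R,
        I p <-> exists w : 'rV[R]_(free_rk F 1), p%:M = w *m d 0%N :> 'M[R]_1,
      forall (i : nat) (w : 'rV[R]_(free_rk F i.+1)),
        w *m d i = 0 <-> exists w' : 'rV[R]_(free_rk F i.+2), w = w' *m d i.+1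
    & forall (i : nat) (u : 'I_(free_rk F i.+1)) (v : 'I_(free_rk F i)),
        R_plus (d i u v)].

Definition has_min_graded_resolution (I : R -> Prop) (F : seq (seq nat)) : Prop :=
  exists d : forall i : nat, 'M[R]_(free_rk F i.+1, free_rk F i),
    min_graded_resolution I d.

End Ideals.

Section MatrixV.
Variable k : fieldType.
Local Notation R := {mpoly k[3]}.

Definition xv : R := 'X_(@Ordinal 3 0 isT).
Definition yv : R := 'X_(@Ordinal 3 1 isT).
Definition zv : R := 'X_(@Ordinal 3 2 isT).

(* The indices i, j are 0-based: i.+1, j.+1 are the usual ones. *)
Definition Umx (s : nat) : 'M[R]_s :=
  \matrix_(i < s, j < s)
    if (i.+1 + j.+1 == s)%N then xv
    else if (i.+1 + j.+1 == s.+1)%N then zv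
    else if (i.+1 + j.+1 == s.+2)%N then yv
    else 0.

Definition Ox2 (s : nat) : 'cV[R]_s :=
  \col_(i < s) if i.+1 == s then xv ^+ 2 else 0.

Definition yO (s : nat) : 'rV[R]_s :=
  \row_(j < s) if j == 0%N :> nat then yv else 0.

Definition Vmx (s : nat) : 'M[R]_(s + (1 + s)) :=
  block_mx 0                             (row_mx (Ox2 s) (Umx s)^T)
           (col_mx (- (Ox2 s)^T) (- Umx s)) (block_mx 0              (yO s)
                                                    (- (yO s)^T)   0).

Definition mid (s : nat) : 'I_(s + (1 + s)) := rshift s (lshift s ord0).

Definition Iss (s : nat) : R -> Prop :=
  ideal_add
    (ideal_gen (fun p => exists2 j, j != mid s & p = pf_minor (Vmx s) j))
    (ideal_mul_elt (@R_plus k) (pf_minor (Vmx s) (mid s))).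

End MatrixV.

Arguments Umx k s : clear implicits.
Arguments Vmx k s : clear implicits.
Arguments Iss k s : clear implicits.

(* Main.v *)
From HB Require Import structures.
Require Import Defs.
From mathcomp Require Import all_boot all_algebra.
From mathcomp Require Import ring zify.

(* Let D_0 = 1, D_1 = z, D_(j+1) = z D_j - x y D_(j-1).  Expanding the Pfaffians of
   V_s^s gives, up to sign, y^(s-j) D_j and x^(s+1-j) D_j for j < s, and D_s for the
   middle one, so that I is generated by the 2s+2 elements f_j = y^(s-j) D_j (j < s)
   and g_j = x^(s+1-j) D_j (j <= s+1).  As R is free over k[x,y] on the D_j, and
   z D_j = D_(j+1) + x y D_(j-1), the ideal I is the k-span of the x^a y^b D_j with
   a + j > s, or b > 0 and b + j >= s.  Generators, socle and Hilbert function are read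
   off this monomial description.
   The syzygies come from the recurrence of the D_j.  Exactness at the relations is a
   direct computation with divisibility by x and y.  Exactness at the generators
   follows from it: the Koszul relations show that x^(s+1) and y^s kill the homology
   there, and (x, y, z) is regular. *)

Set Implicit Arguments.
Unset Strict Implicit.
Unset Printing Implicit Defensive.

(** * The generators and their relations *)

(** The D_j are homogenised Chebyshev polynomials of the second kind: reversing the columns of U_j^j
    gives a tridiagonal Toeplitz matrix, with z on the diagonal and x, y beside it, whose
    determinant is D_j. This is why a three-term recurrence governs all the Pfaffians. The D_j are
    monic in z with integer coefficients, hence no restriction on the field. In the monomials of
    k[x,y,z] the ideal I is in general not monomial. Passing to the D_j makes it so, at the price
    that multiplication by z has two terms. The price stays low because x^a y^b D_j and the second
    term x^(a+1) y^(b+1) D_(j-1) of its product by z share a + j and b + j, the sums that the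
    description of I compares with s. Cancellation between such terms has to be excluded for the
    socle alone. The socle is spanned by the classes of D_s and x^s y^(s-1); their degrees plus 3
    are the last shifts s + 3 and 2s + 2 of the resolution. *)

Section Cheb.
Import GRing.Theory.
Local Open Scope ring_scope.
Variables (R : comNzRingType) (x y z : R).

(* The index is shifted: [cheb j.+1] is D_j, and [cheb 0 = 0] stands for D_(-1). *)
Fixpoint cheb (n : nat) : R :=
  match n with
  | 0 => 0
  | n'.+1 => match n' with
             | 0 => 1
             | n''.+1 => z * cheb n' - x * y * cheb n''
             end
  end.

Arguments cheb : simpl never.

Lemma cheb0 : cheb 0 = 0. Proof. by []. Qed.

Lemma cheb1 : cheb 1 = 1. Proof. by []. Qed.

Lemma chebSS n : cheb n.+2 = z * cheb n.+1 - x * y * cheb n.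
Proof. by []. Qed.

(** The recurrence loses its second term modulo x y. Through this, D_n inherits from z^n its
    regularity modulo y and modulo powers of x and y. *)
Lemma cheb_modxy n : exists q, cheb n.+1 = z ^+ n + x * y * q.
Proof.
suff [] : (exists q, cheb n.+1 = z ^+ n + x * y * q) /\
  (exists q, cheb n.+2 = z ^+ n.+1 + x * y * q) by [].
elim: n => [|n [[q Hq] [q' Hq']]].
  split; first by exists 0; rewrite cheb1 expr0; ring.
  by exists 0; rewrite chebSS cheb1 cheb0 expr1; ring.
split; first by exists q'.
exists (z * q' - cheb n.+1); rewrite chebSS Hq'.
by rewrite [in RHS]exprS; ring.
Qed.

End Cheb.

Arguments cheb : simpl never.

Section Image.
Import GRing.Theory.
Local Open Scope ring_scope.
Variables (R : comNzRingType) (m n : nat) (M : 'M[R]_(m, n)).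

Definition im_mx (w : 'rV[R]_n) : Prop := exists w', w = w' *m M.

Lemma im_mx0 : im_mx 0.
Proof. by exists 0; rewrite mul0mx. Qed.

Lemma im_mxD w1 w2 : im_mx w1 -> im_mx w2 -> im_mx (w1 + w2).
Proof. by move=> [a ->] [b ->]; exists (a + b); rewrite mulmxDl. Qed.

Lemma im_mxZ c w : im_mx w -> im_mx (c *: w).
Proof. by move=> [a ->]; exists (c *: a); rewrite scalemxAl. Qed.

Lemma im_mx_row i : im_mx (row i M).
Proof. by exists (delta_mx 0 i); rewrite rowE. Qed.

Lemma im_mx_sum (I : Type) (r : seq I) (F : I -> 'rV[R]_n) :
  (forall i, im_mx (F i)) -> im_mx (\sum_(i <- r) F i).
Proof.
move=> HF; elim/big_rec: _ => [|i w _ Hw]; first exact: im_mx0.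
exact: im_mxD.
Qed.

End Image.

Section Entries.
Import GRing.Theory.
Local Open Scope ring_scope.

(* Entries indexed by [nat] spare the casts between provably equal dimensions. *)
Definition natmx (R : Type) (m n : nat) (e : nat -> nat -> R) : 'M[R]_(m, n) :=
  \matrix_(u < m, v < n) e u v.

Definition natrow (R : nmodType) (n : nat) (w : 'rV[R]_n) (i : nat) : R :=
  if insub i is Some j then w 0 j else 0.

Lemma natrowE (R : nmodType) n (w : 'rV[R]_n) (i : 'I_n) : natrow w i = w 0 i.
Proof. by rewrite /natrow valK. Qed.

Lemma mul_row_natmx (R : nzRingType) m n (w : 'rV[R]_m) e (v : 'I_n) :
  (w *m natmx m n e) 0 v = \sum_(0 <= u < m) natrow w u * e u v.
Proof.
rewrite mxE big_mkord; apply: eq_bigr => u _.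
by rewrite mxE natrowE.
Qed.

Lemma sum_nat_delta (R : comNzRingType) N (w : nat -> R) c k :
  \sum_(0 <= u < N) w u * (c * (u == k)%:R) = if (k < N)%N then c * w k else 0.
Proof.
case: ltnP => hk; last first.
  rewrite big_nat big1 // => u /andP[_ hu].
  by rewrite ltn_eqF ?mulr0 //; apply: leq_trans hk.
rewrite (bigD1_seq k) ?iota_uniq ?mem_index_iota //= eqxx mulr1 mulrC.
by rewrite big1 ?addr0 // => u /negPf ->; rewrite !mulr0.
Qed.

End Entries.

Section Maps.
Import GRing.Theory.
Local Open Scope ring_scope.
Variables (R : comNzRingType) (x y z : R) (n : nat).
Local Notation C := (cheb x y z).

(* Here s = n.+1.  The indices u < n.+1 are those of the f_u, and n.+1 + j that of g_j. *)
Definition gen (u : nat) : R :=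
  if (u < n.+1)%N then y ^+ (n.+1 - u) * C u.+1
  else x ^+ (n.+2 - (u - n.+1)) * C (u - n.+1).+1.

(* y f_(j+1) - z f_j + x f_(j-1), for j < n. *)
Definition syzA (j v : nat) : R :=
  y * (v == j.+1)%:R - z * (v == j)%:R + x * (v.+1 == j)%:R.

(* x g_(j+1) - z g_j + y g_(j-1), for j < n.+2. *)
Definition syzB (j v : nat) : R :=
  x * (v == (n.+1 + j.+1)%N)%:R - z * (v == (n.+1 + j)%N)%:R
  + y * ((n < v)%N && (v.+1 == (n.+1 + j)%N))%:R.

(* x^2 f_n = y g_n, y D_s = z f_n - x f_(n-1) times x, and the same
   times z, where z D_s = g_(n+2) + x f_n. *)
Definition syzC (c v : nat) : R :=
  match c with
  | 0 => x ^+ 2 * (v == n)%:R - y * (v == (n.+1 + n)%N)%:R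
  | 1 => x * z * (v == n)%:R - x ^+ 2 * (v.+1 == n)%:R - y * (v == (n.+1 + n.+1)%N)%:R
  | _ => (z ^+ 2 - x * y) * (v == n)%:R - x * z * (v.+1 == n)%:R
         - y * (v == (n.+1 + n.+2)%N)%:R
  end.

Definition syz (u v : nat) : R :=
  if (u < n)%N then syzA u v
  else if (u < n + n.+2)%N then syzB (u - n) v
  else syzC (u - (n + n.+2)) v.

(* Row 0 is the syzygy of degree s + 3, any other row that of degree 2s + 2. *)
Definition ssyz (t u : nat) : R :=
  match t with
  | 0 => if (u < n)%N then 0
         else if (u < n + n.+2)%N then y * (u == (n + n.+1)%N)%:R
         else match (u - (n + n.+2))%N with 0 => y | 1 => - z | _ => x end
  | _ => if (u < n)%N then - (x ^+ (n.+2 - u) * C u.+1)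
         else if (u < n + n.+1)%N then y ^+ (n.+1 - (u - n)) * C (u - n).+1
         else if (u < n + n.+2)%N then 0
         else match (u - (n + n.+2))%N with
              | 0 => - C n.+2 | 1 => x * C n.+1 | _ => 0 end
  end.

Lemma sum_split3 a b (F : nat -> R) :
  \sum_(0 <= u < a + b + 3) F u =
  \sum_(0 <= u < a) F u + \sum_(0 <= u < b) F (a + u)%N
  + (F (a + b)%N + F (a + b).+1 + F (a + b).+2).
Proof.
rewrite !big_mkord !big_split_ord /=; congr (_ + _ + _).
rewrite !big_ord_recl big_ord0 /= addr0 addrA addn0.
by rewrite /bump /= !add1n !addnS addn0.
Qed.

Lemma sum_syz N2 (w : nat -> R) v : N2 = (n + n.+2 + 3)%N ->
  \sum_(0 <= u < N2) w u * syz u v =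
  \sum_(0 <= j < n) w j * syzA j v + \sum_(0 <= j < n.+2) w (n + j)%N * syzB j v
  + (w (n + n.+2)%N * syzC 0 v + w (n + n.+2).+1 * syzC 1 v + w (n + n.+2).+2 * syzC 2 v).
Proof.
move=> ->; rewrite sum_split3; congr (_ + _ + (_ + _ + _)).
- by rewrite !big_nat; apply: eq_bigr => j /andP[_ hj]; rewrite /syz hj.
- rewrite !big_nat; apply: eq_bigr => j /andP[_ hj]; rewrite /syz.
  by rewrite ltnNge leq_addr /= ltn_add2l hj addKn.
- by rewrite /syz !ifF ?subnn //; lia.
- by rewrite /syz !ifF ?subSn ?subnn //; lia.
- by rewrite /syz !ifF ?subSn ?subnn //; lia.
Qed.

(** Transposes the definition: the coefficient at f_v collects the at most three relations that
    involve f_v, and the conditions cut off those outside the range. *)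
Lemma sum_syzA (w : nat -> R) v :
  \sum_(0 <= j < n) w j * syzA j v =
    (if (0 < v)%N && (v.-1 < n)%N then y * w v.-1 else 0)
    - (if (v < n)%N then z * w v else 0) + (if (v.+1 < n)%N then x * w v.+1 else 0).
Proof.
transitivity (\sum_(0 <= j < n) w j * ((if (0 < v)%N then y else 0) * (j == v.-1)%:R)
   - \sum_(0 <= j < n) w j * (z * (j == v)%:R)
   + \sum_(0 <= j < n) w j * (x * (j == v.+1)%:R)).
  rewrite -sumrB -big_split /=; apply: eq_bigr => j _.
  rewrite -mulrBr -mulrDr /syzA (eq_sym v j) (eq_sym v.+1 j).
  by case: v => [|v] /=; rewrite ?eqSS ?(eq_sym v j) ?mul0r ?mulr0.
rewrite !sum_nat_delta; congr (_ - _ + _).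
by case: v => [|v] //=; case: ifP => //; rewrite mul0r.
Qed.

Lemma sum_syzB_f (w : nat -> R) v : (v < n.+1)%N ->
  \sum_(0 <= j < n.+2) w j * syzB j v = 0.
Proof.
move=> hv; rewrite big1 // => j _; rewrite /syzB.
have -> : (v == n.+1 + j.+1)%N = false by lia.
have -> : (v == n.+1 + j)%N = false by lia.
have -> : (n < v)%N = false by lia.
by rewrite /= !mulr0 subr0 addr0 mulr0.
Qed.

Lemma sum_syzA_g (w : nat -> R) i :
  \sum_(0 <= j < n) w j * syzA j (n.+1 + i) = 0.
Proof.
rewrite big_nat big1 // => j /andP[_ hj]; rewrite /syzA.
have -> : (n.+1 + i == j.+1)%N = false by lia.
have -> : (n.+1 + i == j)%N = false by lia.
have -> : ((n.+1 + i).+1 == j)%N = false by lia.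
by rewrite /= !mulr0 subr0 addr0 mulr0.
Qed.

Lemma sum_syzB_g (w : nat -> R) i :
  \sum_(0 <= j < n.+2) w j * syzB j (n.+1 + i) =
    (if (0 < i)%N && (i.-1 < n.+2)%N then x * w i.-1 else 0)
    - (if (i < n.+2)%N then z * w i else 0) + (if (i.+1 < n.+2)%N then y * w i.+1 else 0).
Proof.
transitivity (\sum_(0 <= j < n.+2) w j * ((if (0 < i)%N then x else 0) * (j == i.-1)%:R)
   - \sum_(0 <= j < n.+2) w j * (z * (j == i)%:R)
   + \sum_(0 <= j < n.+2) w j * (y * (j == i.+1)%:R)).
  rewrite -sumrB -big_split /=; apply: eq_bigr => j _.
  rewrite -mulrBr -mulrDr /syzB leq_addr /= -addnS !eqn_add2l.
  rewrite (eq_sym i j) (eq_sym i.+1 j).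
  by case: i => [|i] /=; rewrite ?eqSS ?(eq_sym i j) ?mul0r ?mulr0.
rewrite !sum_nat_delta; congr (_ - _ + _).
by case: i => [|i] //=; rewrite mul0r.
Qed.

Lemma syzC_f (v : nat) : (v < n.+1)%N ->
  [/\ syzC 0 v = x ^+ 2 * (v == n)%:R,
      syzC 1 v = x * z * (v == n)%:R - x ^+ 2 * (v.+1 == n)%:R
    & syzC 2 v = (z ^+ 2 - x * y) * (v == n)%:R - x * z * (v.+1 == n)%:R].
Proof.
move=> hv; rewrite /syzC.
have -> : (v == n.+1 + n)%N = false by lia.
have -> : (v == n.+1 + n.+1)%N = false by lia.
have -> : (v == n.+1 + n.+2)%N = false by lia.
by rewrite /= !mulr0 !subr0.
Qed.

Lemma syzC_g (i : nat) :
  [/\ syzC 0 (n.+1 + i) = - (y * (i == n)%:R),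
      syzC 1 (n.+1 + i) = - (y * (i == n.+1)%:R)
    & syzC 2 (n.+1 + i) = - (y * (i == n.+2)%:R)].
Proof.
rewrite /syzC !eqn_add2l.
have -> : (n.+1 + i == n)%N = false by lia.
have -> : ((n.+1 + i).+1 == n)%N = false by lia.
by rewrite /= !(mulr0, subr0, sub0r).
Qed.

Lemma expB m j (a : R) : (j < m)%N -> a ^+ (m - j) = a * a ^+ (m - j.+1).
Proof. by move=> hj; rewrite -exprS; congr (_ ^+ _); lia. Qed.

End Maps.
Arguments syzC : simpl never.
Arguments ssyz : simpl never.

(** * The maps compose to zero *)

Section Complex.
Import GRing.Theory.
Local Open Scope ring_scope.
Variables (R : comNzRingType) (x y z : R) (n : nat).
Local Notation C := (cheb x y z).
Local Notation gn := (gen x y z n).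
Local Notation sz := (syz x y z n).
Local Notation ssz := (ssyz x y z n).

Lemma gen_f j : (j < n.+1)%N -> gn j = y ^+ (n.+1 - j) * C j.+1.
Proof. by rewrite /gen => ->. Qed.

Lemma gen_g j : gn (n.+1 + j) = x ^+ (n.+2 - j) * C j.+1.
Proof. by rewrite /gen ltnNge leq_addr /= addKn. Qed.

Lemma sum_gen_delta c k :
  \sum_(0 <= v < n.+1 + n.+3) gn v * (c * (v == k)%:R) =
  if (k < n.+1 + n.+3)%N then c * gn k else 0.
Proof. exact: sum_nat_delta. Qed.

Lemma sum_gen_deltaS c k :
  \sum_(0 <= v < n.+1 + n.+3) gn v * (c * (v.+1 == k)%:R) =
  if (0 < k <= n.+1 + n.+3)%N then c * gn k.-1 else 0.
Proof.
case: k => [|k]; last exact: (sum_nat_delta (n.+1 + n.+3) gn c k).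
by rewrite big1 // => v _; rewrite /= !mulr0.
Qed.

(** Up to a common power of y, resp. x, the relations [syzA] and [syzB] are the recurrence of the
    D_j; those of [syzC] compare two expressions of multiples of y D_s, or x^2 f_n with y g_n. *)
Lemma syz_gen u : (u < n + n.+2 + 3)%N ->
  \sum_(0 <= v < n.+1 + n.+3) gn v * sz u v = 0.
Proof.
move=> hu; rewrite /syz; case: (ltnP u n) => hn.
  under eq_bigr do rewrite /syzA mulrDr mulrBr.
  rewrite big_split sumrB /= !sum_gen_delta sum_gen_deltaS //.
  have -> : (u.+1 < n.+1 + n.+3)%N by lia.
  have -> : (u < n.+1 + n.+3)%N by lia.
  case: u hn {hu} => [|u] hn /=.
    rewrite !gen_f; try lia.
    by rewrite subn0 subn1 /= chebSS cheb1 cheb0 [y ^+ n.+1]exprS; ring.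
  rewrite ifT; last lia.
  rewrite !gen_f; try lia.
  rewrite chebSS (@expB _ n.+1 u) ?(@expB _ n.+1 u.+1); try lia.
  by ring.
case: (ltnP u (n + n.+2)) => hn2.
  have [j -> hj] : exists2 j, u = (n + j)%N & (j < n.+2)%N by exists (u - n)%N; lia.
  rewrite addKn.
  under eq_bigr do rewrite /syzB mulrDr mulrBr.
  rewrite big_split sumrB /= !sum_gen_delta.
  rewrite !ifT; try lia.
  have -> : \sum_(0 <= v < n.+1 + n.+3)
      gn v * (y * ((n < v)%N && (v.+1 == (n.+1 + j)%N))%:R) =
      if (0 < j)%N then y * gn (n.+1 + j.-1) else 0.
    case: j hj => [|j] hj /=.
      by rewrite big1 // => v _; rewrite (_ : _ && _ = false) ?mulr0 //; lia.
    transitivity (\sum_(0 <= v < n.+1 + n.+3) gn v * (y * (v == n.+1 + j)%N%:R)).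
      by apply: eq_bigr => v _; congr (_ * (_ * (nat_of_bool _)%:R)); lia.
    by rewrite sum_gen_delta ifT //; lia.
  case: j hj => [|j] hj /=.
    by rewrite !gen_g subn0 subn1 /= chebSS cheb1 cheb0 [x ^+ n.+2]exprS; ring.
  rewrite !gen_g chebSS (@expB _ n.+2 j) ?(@expB _ n.+2 j.+1); try lia.
  by ring.
have [c -> hc] : exists2 c, u = (n + n.+2 + c)%N & (c < 3)%N.
  by exists (u - (n + n.+2))%N; lia.
rewrite addKn.
have En : (n.+2 - n = 2)%N by lia.
have En1 : (n.+2 - n.+1 = 1)%N by lia.
(* f_(n-1) = y^2 D_(n-1) does not exist for n = 0; the convention D_(-1) = 0 keeps the formula
   valid. *)
have Cn b : (if (0 < n <= n.+1 + n.+3)%N then x * b * gn n.-1 else 0)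
   = x * b * y ^+ 2 * C n.
  case: (n) => [|m] /=; first by rewrite cheb0 mulr0.
  rewrite ifT; last lia.
  rewrite /gen ifT; last lia.
  by rewrite (_ : m.+2 - m = 2)%N; [ring | lia].
case: c hc => [|[|[|//]]] _ /=.
- under eq_bigr do rewrite mulrBr.
  rewrite sumrB !sum_gen_delta !ifT; try lia.
  by rewrite gen_f ?gen_g // subSnn En; ring.
- under eq_bigr do rewrite !mulrBr.
  rewrite !sumrB !sum_gen_delta sum_gen_deltaS // expr2 Cn !ifT; try lia.
  by rewrite gen_f ?gen_g // subSnn En1 chebSS; ring.
- under eq_bigr do rewrite !mulrBr.
  rewrite !sumrB !sum_gen_delta sum_gen_deltaS // Cn !ifT; try lia.
  by rewrite gen_f ?gen_g // subSnn subnn !chebSS; ring.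
Qed.

(** Row 0 takes the three [syzC] relations with weights y, -z, x: their f-parts cancel and their
    g-parts add up to -y times the last [syzB] relation. Row 1 weights the j-th relation of [syzA]
    by -g_j and that of [syzB] by f_j. The coefficient at f_v is then a [syzB] relation between the
    g's, and the one at g_i a [syzA] relation between the f's; only indices near n survive, and the
    weights of [syzC] absorb them. *)
Lemma ssyz_syz t v : (v < n.+1 + n.+3)%N ->
  \sum_(0 <= u < n + n.+2 + 3) ssz t u * sz u v = 0.
Proof.
move=> hv; rewrite sum_syz //.
set wC0 := ssz t (n + n.+2); set wC1 := ssz t _.+1; set wC2 := ssz t _.+2.
have EC : wC0 = (if t is 0 then y else - C n.+2) /\
   wC1 = (if t is 0 then - z else x * C n.+1) /\ wC2 = (if t is 0 then x else 0).
  rewrite /wC0 /wC1 /wC2 /ssyz.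
  case: t {wC0 wC1 wC2} => [|t]; rewrite !ifF ?subnn ?subSn ?subnn //; try lia.
move: EC => [-> [-> ->]] {wC0 wC1 wC2}.
have [hf|hg] := ltnP v n.+1.
  have [-> -> ->] := syzC_f x y z hf.
  rewrite sum_syzB_f // addr0 sum_syzA.
  case: t => [|t].
    have E u : (u < n)%N -> ssz 0 u = 0 by rewrite /ssyz => ->.
    rewrite (_ : (if _ && _ then _ else _) = 0); last first.
      by case: ifP => // /andP[_ ?]; rewrite E ?mulr0.
    rewrite (_ : (if (v < n)%N then _ else _) = 0); last first.
      by case: ifP => // ?; rewrite E ?mulr0.
    rewrite (_ : (if _ then _ else _) = 0); last first.
      by case: ifP => // ?; rewrite E ?mulr0.
    by ring.
  have E u : (u < n)%N -> ssz t.+1 u = - (x ^+ (n.+2 - u) * C u.+1).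
    by rewrite /ssyz => ->.
  have [hn|hn] := ltnP v.+1 n.
    have -> : (v == n) = false by lia.
    have -> : (v.+1 == n) = false by lia.
    have -> : (v < n)%N by lia.
    have -> : (v.-1 < n)%N by lia.
    rewrite !E //; try lia; case: v hn {hf hv} => [|v] hn /=.
      by rewrite subn0 subn1 /= (chebSS x y z 0) cheb1 cheb0 [x ^+ n.+2]exprS; ring.
    rewrite (chebSS x y z v.+1) (@expB _ n.+2 v) ?(@expB _ n.+2 v.+1); try lia.
    by ring.
  have [hn'|hn'] := ltnP v n.
    have En : n = v.+1 by lia.
    have -> : (v == n) = false by lia.
    have Ev w : (w <= v)%N -> ssz t.+1 w = - (x ^+ (v.+3 - w) * C w.+1).
      by move=> hw; rewrite E; [rewrite En|lia].
    rewrite {}En in Ev *.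
    rewrite eqxx (Ev v) // (_ : v.+3 - v = 3)%N; last lia.
    case: v {hn hn' hv hf} Ev => [|v] Ev /=.
      by rewrite (chebSS x y z 0) cheb1 cheb0; ring.
    rewrite Ev // ltnW // (_ : v.+4 - v = 4)%N; last lia.
    by rewrite (chebSS x y z v.+1); ring.
  have -> : v = n by lia.
  rewrite eqxx; have -> : (n.+1 == n) = false by lia.
  have En : (if (0 < n)%N && (n.-1 < n)%N then y * ssz t.+1 n.-1 else 0) =
     - (y * x ^+ 3 * C n).
    move: E; case: (n) => [|m] E /=; first by rewrite cheb0 mulr0 oppr0.
    by rewrite ltnSn E // (_ : m.+3 - m = 3)%N; [ring|lia].
  by rewrite En chebSS /=; ring.
have [i -> hi] : exists2 i, v = (n.+1 + i)%N & (i < n.+3)%N.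
  by exists (v - n.+1)%N; lia.
have [-> -> ->] := syzC_g x y z n i.
rewrite sum_syzA_g add0r sum_syzB_g.
case: t => [|t].
  have E j : (j < n.+2)%N -> ssz 0 (n + j) = y * (j == n.+1)%:R.
    move=> hj; rewrite /ssyz ltnNge leq_addr /= ltn_add2l hj.
    by rewrite eqn_add2l.
  have [hn|hn] := ltnP i n.
    rewrite !E; try lia.
    have -> : (i == n) = false by lia.
    have -> : (i == n.+1) = false by lia.
    have -> : (i == n.+2) = false by lia.
    have -> : (i.-1 == n.+1) = false by lia.
    have -> : (i.+1 == n.+1) = false by lia.
    by do 3![case: ifP => _]; rewrite /=; ring.
  have [-> | [-> | ->]] : i = n \/ i = n.+1 \/ i = n.+2 by lia.
  - rewrite eqxx.
    have -> : (n == n.+1) = false by lia.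
    have -> : (n == n.+2) = false by lia.
    have -> : (n < n.+2)%N by lia.
    rewrite ltnSn !E ?eqxx //; try lia.
    have -> : (n == n.+1) = false by lia.
    have -> : (n.-1 == n.+1) = false by lia.
    by case: ifP => _; rewrite /=; ring.
  - rewrite eqxx.
    have -> : (n.+1 == n) = false by lia.
    have -> : (n.+1 == n.+2) = false by lia.
    rewrite ltnn ltnSn /= ltnW // !E ?eqxx //.
    have -> : (n == n.+1) = false by lia.
    by rewrite /=; ring.
  - have -> : (n.+2 == n) = false by lia.
    have -> : (n.+2 == n.+1) = false by lia.
    have -> : (n.+3 < n.+2)%N = false by lia.
    by rewrite ltnn ltnSn !E ?eqxx //=; ring.
have E j : (j < n.+1)%N -> ssz t.+1 (n + j) = y ^+ (n.+1 - j) * C j.+1.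
  by move=> hj; rewrite /ssyz ltnNge leq_addr /= ltn_add2l hj addKn.
have E' : ssz t.+1 (n + n.+1) = 0.
  by rewrite /ssyz ltnNge leq_addr /= ltnn ltn_add2l ltnSn.
have [hn|hn] := ltnP i n.
  have -> : (i == n) = false by lia.
  have -> : (i == n.+1) = false by lia.
  have -> : (i == n.+2) = false by lia.
  case: i hn {hi hg} => [|i] hn /=.
    rewrite !E //; try lia.
    by rewrite subn0 subn1 /= (chebSS x y z 0) cheb1 cheb0 [y ^+ n.+1]exprS; ring.
  rewrite !ifT; try lia.
  rewrite !E //; try lia.
  rewrite (chebSS x y z i.+1) (@expB _ n.+1 i) ?(@expB _ n.+1 i.+1); try lia.
  by ring.
have [-> | [-> | ->]] : i = n \/ i = n.+1 \/ i = n.+2 by lia.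
- rewrite eqxx.
  have -> : (n == n.+1) = false by lia.
  have -> : (n == n.+2) = false by lia.
  have -> : (n < n.+2)%N by lia.
  rewrite ltnSn E' (E n) // subSnn.
  have En : (if (0 < n)%N && (n.-1 < n.+2)%N then x * ssz t.+1 (n + n.-1) else 0) =
     (x * y ^+ 2 * C n).
    move: E; case: (n) => [|m] E /=; first by rewrite cheb0 mulr0.
    by rewrite !ltnS leqW // E // (_ : m.+2 - m = 2)%N; [ring|lia].
  by rewrite En chebSS /=; ring.
- rewrite eqxx.
  have -> : (n.+1 == n) = false by lia.
  have -> : (n.+1 == n.+2) = false by lia.
  by rewrite ltnn ltnSn /= ltnW // E' (E n) // subSnn /=; ring.
- have -> : (n.+2 == n) = false by lia.
  have -> : (n.+2 == n.+1) = false by lia.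
  have -> : (n.+3 < n.+2)%N = false by lia.
  by rewrite ltnn ltnSn /= E'; ring.
Qed.

End Complex.

(** * Exactness *)

Section Exact.
Import GRing.Theory.
Local Open Scope ring_scope.
Variables (R : idomainType) (x y z : R) (n : nat).
Hypothesis (y0 : y != 0).
Hypothesis regxy : forall a b, y * a = x * b -> exists c, a = x * c /\ b = y * c.
Hypothesis regyz : forall a b, z * a = y * b -> exists c, a = y * c.
Local Notation C := (cheb x y z).
Local Notation gn := (gen x y z n).
Local Notation sz := (syz x y z n).
Local Notation ssz := (ssyz x y z n).

Lemma zX_coprime m a b : z ^+ m * a = y * b -> exists c, a = y * c.
Proof.
elim: m a b => [|m IHm] a b; first by rewrite expr0 mul1r; exists b.
rewrite exprSr -mulrA => /IHm [c /esym H].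
by apply: (regyz (b := c)); rewrite H.
Qed.

Lemma cheb_coprime m a b : C m.+1 * a = y * b -> exists c, a = y * c.
Proof.
have [q ->] := cheb_modxy x y z m => H.
apply: (@zX_coprime m _ (b - x * q * a)).
by rewrite mulrBr -H; ring.
Qed.

(** If B_j = y^(m-j) D_j l up to m, the next equation reads y B_(m+1) = D_(m+1) l. As D_(m+1) is
    regular modulo y, l is divisible by y: each step costs one more factor y in all earlier
    terms. *)
Lemma cheb_rec_solve m (B : nat -> R) :
  (forall i, (i < m)%N ->
     y * B i.+1 = z * B i - (if i is i'.+1 then x * B i' else 0)) ->
  exists l, forall j, (j <= m)%N -> B j = y ^+ (m - j) * C j.+1 * l.
Proof.
elim: m => [|m IHm] HB.
  by exists (B 0) => [[]]// _; rewrite cheb1; ring.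
have [|l Hl] := IHm; first by move=> i hi; apply: HB; lia.
have Hm : y * B m.+1 = C m.+2 * l.
  rewrite HB // Hl // subnn expr0 mul1r.
  case: m {HB IHm} Hl => [|m] Hl; first by (rewrite chebSS cheb0; ring).
  by rewrite Hl // subSnn (chebSS x y z m.+1); ring.
have [l' Hl'] := cheb_coprime (esym Hm).
exists l' => j; rewrite leq_eqVlt => /orP[/eqP ->|hj].
  by apply: (mulfI y0); rewrite Hm Hl' subnn; ring.
by rewrite Hl // subSn // Hl' exprS; ring.
Qed.

(** The columns of g_0, ..., g_(n-1) give the recurrence solved by [cheb_rec_solve] for the weights
    of [syzB]. The columns of g_(n+2), g_(n+1) and g_n bring in t and m and fix the weights of
    [syzC]. The columns of the f's then determine the weights of [syzA], from the top index down. *)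
Lemma syz_exact (w : nat -> R) :
  (forall v, (v < n.+1 + n.+3)%N ->
     \sum_(0 <= u < n + n.+2 + 3) w u * sz u v = 0) ->
  exists t m, forall u, (u < n + n.+2 + 3)%N -> w u = t * ssz 0 u + m * ssz 1 u.
Proof.
move=> Hw.
pose B j := w (n + j)%N.
set c0 := w (n + n.+2)%N; set c1 := w (n + n.+2).+1; set c2 := w (n + n.+2).+2.
have Eg i : (i < n.+3)%N ->
    (if (0 < i)%N then x * B i.-1 else 0)
    - (if (i < n.+2)%N then z * B i else 0) + (if (i.+1 < n.+2)%N then y * B i.+1 else 0)
    = y * (c0 * (i == n)%:R + c1 * (i == n.+1)%:R + c2 * (i == n.+2)%:R).
  move=> hi; have := Hw (n.+1 + i)%N; rewrite sum_syz // sum_syzA_g sum_syzB_g add0r.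
  have [-> -> ->] := syzC_g x y z n i.
  have -> : (i.-1 < n.+2)%N by lia.
  rewrite andbT -/c0 -/c1 -/c2 -/(B i) -/(B i.+1) -/(B i.-1) => H.
  apply: subr0_eq; rewrite -[RHS]H; last lia.
  by rewrite mulrDr mulrDr !mulrN -!opprD !(mulrCA y).
have [l Hl] : exists l, forall j, (j <= n)%N -> B j = y ^+ (n - j) * C j.+1 * l.
  apply: cheb_rec_solve => i hi.
  have := Eg i; have -> : (i == n) = false by lia.
  have -> : (i == n.+1) = false by lia.
  have -> : (i == n.+2) = false by lia.
  have -> : (i < n.+2)%N by lia.
  have -> : (i.+1 < n.+2)%N by lia.
  rewrite !mulr0 !addr0 mulr0 => H; apply: subr0_eq; rewrite -[RHS]H; last lia.
  by case: i {H hi} => [|i] /=; ring.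
have Bn : B n = C n.+1 * l by rewrite Hl // subnn expr0 mul1r.
have E2 : y * c2 = x * B n.+1.
  have := Eg n.+2 (leqnn _); rewrite ltnn eqxx.
  have -> : (n.+3 < n.+2)%N = false by lia.
  have -> : (n.+2 == n) = false by lia.
  have -> : (n.+2 == n.+1) = false by lia.
  by rewrite /= !mulr0 subr0 addr0 !add0r mulr1.
(* t is the multiple of row 0 of [ssyz], whose only nonzero [syzB] weight is y, at index n + 1. *)
have [t [Hc2 Bn1]] := regxy E2.
have E1 : x * (C n.+1 * l) = y * (z * t + c1).
  have := Eg n.+1; rewrite ltnn eqxx ltnSn /= Bn Bn1.
  have -> : (n.+1 == n) = false by lia.
  have -> : (n.+1 == n.+2) = false by lia.
  move=> H; apply/eqP; rewrite -subr_eq0; apply/eqP.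
  rewrite (_ : x * (C n.+1 * l) = (x * (C n.+1 * l) - z * (y * t) + 0) + z * (y * t)); last ring.
  by rewrite H; [rewrite /=; ring | lia].
(* By [E1], y divides x D_n l, hence D_n l, hence l; the quotient m is the multiple of row 1. *)
have [m Hlm] : exists m, l = y * m.
  have [c [_ Hc]] := regxy (esym E1).
  exact: cheb_coprime Hc.
have Hc1 : c1 = x * C n.+1 * m - z * t.
  apply: (mulfI y0); apply: (addrI (y * (z * t))).
  by rewrite -mulrDr -E1 Hlm; ring.
have Hc0 : c0 = - C n.+2 * m + y * t.
  apply: (mulfI y0); have := Eg n; rewrite eqxx.
  have -> : (n == n.+1) = false by lia.
  have -> : (n == n.+2) = false by lia.
  have -> : (n < n.+2)%N by lia.
  have -> : (n.+1 < n.+2)%N by lia.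
  have -> : (if (0 < n)%N then x * B n.-1 else 0) = x * (y * C n * l).
    case: (n) Hl => [|k] Hl /=; first by (rewrite cheb0; ring).
    by rewrite Hl // subSnn expr1.
  rewrite Bn Bn1 Hlm /= mulr1 !mulr0 !addr0 => <-; last lia.
  by rewrite chebSS; ring.
(* The weights of [syzA] are prolonged by -g_n m and -g_(n+1) m: with these two values the
   contributions of [syzC] to the columns of f_(n-1) and f_n take the form of the recurrence
   [EA]. *)
pose A j := if (j < n)%N then w j
  else if j == n then - (x ^+ 2 * C n.+1 * m) else - (x * C n.+2 * m).
have EA i : (0 < i <= n)%N -> y * A i.-1 = z * A i - x * A i.+1.
  move=> /andP[i0 hi]; have := Hw i; rewrite sum_syz // sum_syzA sum_syzB_f //.
  have [|-> -> ->] := @syzC_f _ x y z n i; first lia.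
  have -> : (i.-1 < n)%N by lia.
  rewrite i0 /= -/c0 -/c1 -/c2 Hc0 Hc1 Hc2 => H.
  have {}H := H ltac:(lia).
  rewrite /A; have -> : (i.-1 < n)%N by lia.
  move: H; have [hin|hin|hin] := ltngtP i n.
  - have [hin1|hin1|hin1] := ltngtP i.+1 n.
    + by move=> H; apply: subr0_eq; rewrite -[RHS]H /=; ring.
    + lia.
    + by move=> H; apply: subr0_eq; rewrite -[RHS]H -hin1 /=; ring.
  - lia.
  - rewrite hin ltnNge leqnSn /=.
    have -> : (n.+1 == n) = false by lia.
    by move=> H; apply: subr0_eq; rewrite -[RHS]H chebSS /=; ring.
(* Downward induction from the two prolonged values: the sequence -g_j m satisfies [EA], and y can
   be cancelled. *)
have HA i : (i <= n)%N -> A i.+1 = - (x ^+ (n.+1 - i) * C i.+2 * m) /\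
      A i = - (x ^+ (n.+2 - i) * C i.+1 * m).
  move=> hi; rewrite -(subKn hi); move: (n - i)%N (leq_subr i n) => {hi}i.
  elim: i => [|i IHi] hi.
    rewrite subn0 subSnn (_ : n.+2 - n = 2)%N; last lia.
    rewrite /A eqxx ltnn ltnNge leqnSn /=.
    by have -> : (n.+1 == n) = false by lia.
  have [|] := IHi; first lia.
  have := EA (n - i)%N; rewrite (_ : (n - i = (n - i.+1).+1)%N); last lia.
  set j := (n - i.+1)%N => /= H Hj2 Hj1.
  have hj : (j < n)%N by rewrite /j; lia.
  split; first by rewrite Hj1; congr (- (_ ^+ _ * _ * _)); lia.
  apply: (mulfI y0); rewrite H ?Hj2 ?Hj1; last lia.
  rewrite (_ : n.+2 - j.+1 = n.+1 - j)%N; last lia.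
  rewrite (_ : n.+2 - j = (n.+1 - j).+1)%N; last lia.
  rewrite (_ : n.+1 - j = (n - j).+1)%N; last lia.
  rewrite (_ : n.+1 - j.+1 = n - j)%N; last lia.
  by rewrite (chebSS x y z j.+1) !exprS; ring.
exists t, m => u hu.
have [hun|hun] := ltnP u n.
  have [|_] := HA u; first lia.
  rewrite /A hun => ->; rewrite /ssyz hun; ring.
have [hun2|hun2] := ltnP u (n + n.+1).
  have -> : u = (n + (u - n))%N by lia.
  rewrite -/(B _) Hl; last lia.
  rewrite Hlm /ssyz.
  have -> : (n + (u - n))%N = u by lia.
  have -> : (u < n)%N = false by lia.
  have -> : (u < n + n.+2)%N by lia.
  have -> : (u == n + n.+1)%N = false by lia.
  have -> : (n.+1 - (u - n) = (n - (u - n)).+1)%N by lia.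
  by rewrite hun2 exprS /=; ring.
have [hun3|hun3] := ltnP u (n + n.+2).
  have -> : u = (n + n.+1)%N by lia.
  rewrite -/(B _) Bn1 /ssyz ltnn eqxx.
  have -> : (n + n.+1 < n)%N = false by lia.
  have -> : (n + n.+1 < n + n.+2)%N by lia.
  by rewrite /=; ring.
have [-> | [-> | ->]] : u = (n + n.+2)%N \/ u = (n + n.+2).+1 \/ u = (n + n.+2).+2 by lia.
- rewrite -/c0 Hc0 /ssyz subnn ltnn.
  have -> : (n + n.+2 < n)%N = false by lia.
  have -> : (n + n.+2 < n + n.+1)%N = false by lia.
  by ring.
- rewrite -/c1 Hc1 /ssyz subSnn.
  have -> : ((n + n.+2).+1 < n + n.+2)%N = false by lia.
  have -> : ((n + n.+2).+1 < n)%N = false by lia.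
  have -> : ((n + n.+2).+1 < n + n.+1)%N = false by lia.
  by rewrite /=; ring.
- rewrite -/c2 Hc2 /ssyz subSn // subSnn.
  have -> : ((n + n.+2).+2 < n)%N = false by lia.
  have -> : ((n + n.+2).+2 < n + n.+2)%N = false by lia.
  have -> : ((n + n.+2).+2 < n + n.+1)%N = false by lia.
  by ring.
Qed.

End Exact.

(** The indicators are generalised to arbitrary ring elements: the identities hold formally, before
    any indices are compared. *)
Ltac bool_ring := rewrite ?mxE; repeat (move: ((nat_of_bool _)%:R)%R => ?); ring.

(** * The Koszul syzygies of x^(s+1) and y^s as combinations of the relations *)

Section Koszul.
Import GRing.Theory.
Local Open Scope ring_scope.
Variables (R : comNzRingType) (x y z : R) (n N1 N2 : nat).
(** N1 and N2 are variables because they will be ranks computed from lists of shifts, equal to these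
    sums but not convertible to them. *)
Hypotheses (hN1 : N1 = (n.+1 + n.+3)%N) (hN2 : N2 = (n + n.+2 + 3)%N).
Local Notation C := (cheb x y z).
Local Notation gn := (gen x y z n).
Local Notation sz := (syz x y z n).
Local Notation Im := (im_mx (natmx N2 N1 sz)).

Definition nat_delta (k : nat) : 'rV[R]_N1 := \row_(v < N1) (v == k :> nat)%:R.
(** The free generator of index k - 1, and 0 for k = 0, where a truncated predecessor would wrongly
    give the one of index 0. *)
Definition nat_delta_pred (k : nat) : 'rV[R]_N1 := \row_(v < N1) (v.+1 == k)%:R.
Local Notation e := nat_delta.
Local Notation em := nat_delta_pred.
Local Notation e' k := (nat_delta (n.+1 + k)).

Lemma nat_delta_pred0 : em 0 = 0.
Proof. by apply/rowP => v; rewrite !mxE. Qed.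

Lemma nat_delta_predS k : em k.+1 = e k.
Proof. by apply/rowP => v; rewrite !mxE eqSS. Qed.

Lemma im_syz u : (u < N2)%N -> Im (\row_(v < N1) sz u v).
Proof.
move=> hu; rewrite (_ : \row__ _ = row (Ordinal hu) (natmx N2 N1 sz)).
  exact: im_mx_row.
by apply/rowP => v; rewrite !mxE.
Qed.

Lemma im_eq w1 w2 : w1 = w2 -> Im w1 -> Im w2. Proof. by move->. Qed.

Lemma im_A j : (j < n)%N -> Im (y *: e j.+1 - z *: e j + x *: em j).
Proof.
move=> hj; apply: im_eq (@im_syz j _); last by lia.
by apply/rowP => v; rewrite !mxE /syz hj.
Qed.

Lemma im_B0 : Im (x *: e' 1 - z *: e' 0).
Proof.
apply: im_eq (@im_syz n _); last by lia.
apply/rowP => v; rewrite !mxE /syz ltnn /syzB subnn addn0.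
have -> : (n < n + n.+2)%N by lia.
have -> : ((n < v)%N && (v.+1 == n.+1)) = false by lia.
by rewrite /= mulr0 addr0 addn1.
Qed.

Lemma im_B j : (j < n.+1)%N -> Im (x *: e' j.+2 - z *: e' j.+1 + y *: e' j).
Proof.
move=> hj; apply: im_eq (@im_syz (n + j.+1) _); last by lia.
apply/rowP => v; rewrite !mxE /syz.
have -> : (n + j.+1 < n)%N = false by lia.
have -> : (n + j.+1 < n + n.+2)%N by lia.
rewrite addKn /syzB; congr (_ + _ * (nat_of_bool _)%:R); lia.
Qed.

Lemma im_C0 : Im (x ^+ 2 *: e n - y *: e' n).
Proof.
apply: im_eq (@im_syz (n + n.+2) _); last by lia.
apply/rowP => v; rewrite !mxE /syz ltnn subnn.
by have -> : (n + n.+2 < n)%N = false by lia.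
Qed.

Lemma im_C1 : Im ((x * z) *: e n - x ^+ 2 *: em n - y *: e' n.+1).
Proof.
apply: im_eq (@im_syz (n + n.+2).+1 _); last by lia.
apply/rowP => v; rewrite !mxE /syz subSnn.
have -> : ((n + n.+2).+1 < n + n.+2)%N = false by lia.
by have -> : ((n + n.+2).+1 < n)%N = false by lia.
Qed.

Lemma im_C2 : Im ((z ^+ 2 - x * y) *: e n - (x * z) *: em n - y *: e' n.+2).
Proof.
apply: im_eq (@im_syz (n + n.+2).+2 _); last by lia.
apply/rowP => v; rewrite !mxE /syz.
have -> : ((n + n.+2).+2 - (n + n.+2) = 2)%N by lia.
have -> : ((n + n.+2).+2 < n + n.+2)%N = false by lia.
by have -> : ((n + n.+2).+2 < n)%N = false by lia.
Qed.

(** Modulo the image, y e_(j+1) = z e_j - x e_(j-1), so the rows y^j e_j satisfy the recurrence of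
    the D_j and start at e_0. *)
Lemma im_y_f j : (j <= n)%N ->
  Im (y ^+ j *: e j - C j.+1 *: e 0).
Proof.
elim/ltn_ind: j => [[|[|j]]] IHj hj.
- by apply: im_eq (im_mx0 _); rewrite expr0 cheb1 subrr.
- apply: im_eq (@im_A 0 hj); rewrite nat_delta_pred0.
  by apply/rowP => v; rewrite !mxE chebSS cheb1 cheb0; bool_ring.
- have h1 := im_mxZ (y ^+ j.+1) (@im_A j.+1 hj).
  have h2 := im_mxZ z (IHj j.+1 (leqnn _) (ltnW hj)).
  have h3 := im_mxZ (- (x * y)) (IHj j (leqnSn _) (ltnW (ltnW hj))).
  apply: im_eq (im_mxD h1 (im_mxD h2 h3)); rewrite nat_delta_predS.
  by apply/rowP => v; rewrite !mxE (chebSS x y z j.+1) (exprS y j.+1) (exprS y j); bool_ring.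
Qed.

Lemma im_y_f_pred j : (j <= n.+1)%N ->
  Im (y ^+ j *: em j - (y * C j) *: e 0).
Proof.
case: j => [|j] hj.
  by apply: im_eq (im_mx0 _); rewrite nat_delta_pred0 cheb0 mulr0 scale0r scaler0 subrr.
apply: im_eq (im_mxZ y (@im_y_f j hj)); rewrite nat_delta_predS exprS.
by apply/rowP => v; bool_ring.
Qed.

Lemma im_x_g j : (j <= n.+2)%N ->
  Im (x ^+ j *: e' j - C j.+1 *: e' 0).
Proof.
elim/ltn_ind: j => [[|[|j]]] IHj hj.
- by apply: im_eq (im_mx0 _); rewrite expr0 cheb1 subrr.
- apply: im_eq im_B0.
  by apply/rowP => v; rewrite !mxE chebSS cheb1 cheb0; bool_ring.
- have h1 := im_mxZ (x ^+ j.+1) (@im_B j (ltnSE hj)).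
  have h2 := im_mxZ z (IHj j.+1 (leqnn _) (ltnW hj)).
  have h3 := im_mxZ (- (x * y)) (IHj j (leqnSn _) (ltnW (ltnW hj))).
  apply: im_eq (im_mxD h1 (im_mxD h2 h3)).
  by apply/rowP => v; rewrite !mxE (chebSS x y z j.+1) (exprS x j.+1) (exprS x j); bool_ring.
Qed.

(** Both terms map to x^(s+1-j) y^(s-j) D_j. Downward induction on j: n is the relation x^2 f_n = y
    g_n, n - 1 also uses the second [syzC] relation, and below that one [syzA] and one [syzB]
    relation lead from two consecutive indices to the next. *)
Lemma im_fg j : (j <= n)%N ->
  Im (x ^+ (n.+2 - j) *: e j - y ^+ (n.+1 - j) *: e' j).
Proof.
move=> hj; suff H : forall d, (d <= n)%N ->
    Im (x ^+ d.+2 *: e (n - d) - y ^+ d.+1 *: e' (n - d)).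
  have := H (n - j)%N (leq_subr _ _); rewrite subKn //.
  have -> : (n.+2 - j = (n - j).+2)%N by lia.
  by have -> : (n.+1 - j = (n - j).+1)%N by lia.
elim/ltn_ind => [[|[|d]]] IHd hd.
- by apply: im_eq im_C0; rewrite subn0.
- have E : (n = (n - 1).+1)%N by lia.
  have h1 := im_mxZ (- x) im_C1.
  have h2 := im_mxZ z im_C0.
  have h3 := im_mxZ (- y) (@im_B (n - 1) ltac:(lia)).
  apply: im_eq (im_mxD h1 (im_mxD h2 h3)); rewrite [in em n]E nat_delta_predS -!E.
  by apply/rowP => v; bool_ring.
- have := IHd d.+1 (leqnn _) (ltnW hd); have := IHd d (leqnSn _) (ltnW (ltnW hd)).
  set j' := (n - d.+2)%N.
  rewrite (_ : n - d.+1 = j'.+1)%N; last lia.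
  rewrite (_ : n - d = j'.+2)%N; last lia.
  move=> /(im_mxZ (- (x * y))) h3 /(im_mxZ z) h2.
  have h1 := im_mxZ (x ^+ d.+3) (@im_A j'.+1 ltac:(lia)).
  have h4 := im_mxZ (- y ^+ d.+2) (@im_B j' ltac:(lia)).
  apply: im_eq (im_mxD (im_mxD h1 h4) (im_mxD h2 h3)); rewrite nat_delta_predS.
  rewrite (exprS x d.+3) (exprS x d.+2) (exprS x d.+1) (exprS y d.+2) (exprS y d.+1) (exprS y d).
  by apply/rowP => v; bool_ring.
Qed.

(** Since f_0 = y^s, these are the trivial syzygies between f_0 and the other generators; [koszul_x]
    does the same with g_0 = x^(s+1). *)
Lemma koszul_y u : (u < N1)%N -> Im (y ^+ n.+1 *: e u - gn u *: e 0).
Proof.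
move=> hu; have [hun|hun] := ltnP u n.+1.
  rewrite gen_f //.
  apply: im_eq (im_mxZ (y ^+ (n.+1 - u)) (@im_y_f u (ltnSE hun))).
  apply/rowP => v; rewrite !mxE (_ : y ^+ n.+1 = y ^+ (n.+1 - u) * y ^+ u); first by bool_ring.
  by rewrite -exprD subnK // ltnW.
have [j -> hj] : exists2 j, u = (n.+1 + j)%N & (j < n.+3)%N.
  by exists (u - n.+1)%N; lia.
rewrite gen_g.
have [hjn|hjn] := leqP j n.
  have h1 := im_mxZ (- y ^+ j) (im_fg hjn).
  have h2 := im_mxZ (x ^+ (n.+2 - j)) (im_y_f hjn).
  apply: im_eq (im_mxD h1 h2).
  apply/rowP => v; rewrite !mxE (_ : y ^+ n.+1 = y ^+ (n.+1 - j) * y ^+ j); first by bool_ring.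
  by rewrite -exprD subnK // ltnW.
have h2 := @im_y_f n (leqnn _).
have h3 := @im_y_f_pred n (leqnSn _).
(* g_(n+1) and g_(n+2) have no partner f_j for [im_fg]; [syzC] expresses y times them through f_n
   and f_(n-1). *)
have [->|->] : j = n.+1 \/ j = n.+2 by lia.
  have h1 := im_mxZ (- y ^+ n) im_C1.
  apply: im_eq (im_mxD h1 (im_mxD (im_mxZ (x * z) h2) (im_mxZ (- (x ^+ 2)) h3))).
  apply/rowP => v; rewrite !mxE subSnn chebSS (exprS y n); bool_ring.
have h1 := im_mxZ (- y ^+ n) im_C2.
apply: im_eq (im_mxD h1 (im_mxD (im_mxZ (z ^+ 2 - x * y) h2) (im_mxZ (- (x * z)) h3))).
apply/rowP => v; rewrite !mxE subnn !chebSS (exprS y n); bool_ring.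
Qed.

Lemma koszul_x u : (u < N1)%N -> Im (x ^+ n.+2 *: e u - gn u *: e' 0).
Proof.
move=> hu; have [hun|hun] := ltnP u n.+1.
  rewrite gen_f //.
  have h1 := im_mxZ (x ^+ u) (@im_fg u (ltnSE hun)).
  have h2 := im_mxZ (y ^+ (n.+1 - u)) (@im_x_g u (leqW (ltnW hun))).
  apply: im_eq (im_mxD h1 h2).
  apply/rowP => v; rewrite !mxE (_ : x ^+ n.+2 = x ^+ (n.+2 - u) * x ^+ u); first by bool_ring.
  by rewrite -exprD subnK //; lia.
have [j -> hj] : exists2 j, u = (n.+1 + j)%N & (j <= n.+2)%N.
  by exists (u - n.+1)%N; lia.
rewrite gen_g.
apply: im_eq (im_mxZ (x ^+ (n.+2 - j)) (@im_x_g j hj)).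
apply/rowP => v; rewrite !mxE (_ : x ^+ n.+2 = x ^+ (n.+2 - j) * x ^+ j); first by bool_ring.
by rewrite -exprD subnK.
Qed.

(* Multiplication by [a] kills the homology at the generators as soon as the
   trivial (Koszul) syzygies between one generator and all others are images. *)
Lemma im_of_koszul (a : R) k (w : 'rV[R]_N1) :
  (forall u, (u < N1)%N -> Im (a *: e u - gn u *: e k)) ->
  \sum_(0 <= v < N1) natrow w v * gn v = 0 -> Im (a *: w).
Proof.
move=> HK Hw.
have H : Im (\sum_(v < N1) w 0 v *: (a *: e v - gn v *: e k)).
  by apply: im_mx_sum => v; apply/im_mxZ/HK.
have S0 : \sum_(v < N1) w 0 v * gn v = 0.
  by rewrite -[RHS]Hw big_mkord; apply: eq_bigr => v _; rewrite natrowE.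
apply: im_eq H; rewrite -[RHS]subr0 -[X in _ - X](scale0r (e k)) -S0 scaler_suml.
have -> : a *: w = \sum_(v < N1) w 0 v *: (a *: e v).
  apply/rowP => v; rewrite summxE !mxE (bigD1 v) //= !mxE eqxx mulr1 big1 ?addr0.
    by rewrite mulrC.
  move=> i /negPf hi; rewrite !mxE [_ == _ :> nat]eq_sym.
  by rewrite -[(i == v :> nat)]/(i == v) hi !mulr0.
by rewrite -sumrB; apply: eq_bigr => v _; rewrite scalerBr !scalerA.
Qed.

End Koszul.

(** * Exactness at each free module *)

Section Resolution.
Import GRing.Theory.
Local Open Scope ring_scope.
Variables (R : idomainType) (x y z : R) (n N1 N2 : nat).
Hypotheses (hN1 : N1 = (n.+1 + n.+3)%N) (hN2 : N2 = (n + n.+2 + 3)%N).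
Hypotheses (x0 : x != 0) (y0 : y != 0).
Hypothesis regxy : forall a b, y * a = x * b -> exists c, a = x * c /\ b = y * c.
Hypothesis regyz : forall a b, z * a = y * b -> exists c, a = y * c.
(** The ideal of g_0 and f_0, the two generators whose Koszul syzygies have been obtained. *)
Definition in_pow (p : R) := exists a b, p = a * x ^+ n.+2 + b * y ^+ n.+1.
Hypothesis regz : forall p, in_pow (z * p) -> in_pow p.
Local Notation C := (cheb x y z).
Local Notation gn := (gen x y z n).
Local Notation sz := (syz x y z n).
Local Notation ssz := (ssyz x y z n).

Lemma in_powD p q : in_pow p -> in_pow q -> in_pow (p + q).
Proof.
by move=> [a [b ->]] [c [d ->]]; exists (a + c), (b + d); ring.
Qed.

Lemma in_powM c p : in_pow p -> in_pow (c * p).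
Proof. by move=> [a [b ->]]; exists (c * a), (c * b); ring. Qed.

Lemma regzX k p : in_pow (z ^+ k * p) -> in_pow p.
Proof.
elim: k p => [|k IHk] p; first by rewrite expr0 mul1r.
by rewrite exprSr -mulrA => /IHk/regz.
Qed.

(* [cheb] is monic in [z] modulo [x * y], which is nilpotent modulo the ideal. *)
Lemma reg_cheb k p : in_pow (C k.+1 * p) -> in_pow p.
Proof.
have [q Hq] := cheb_modxy x y z k => Hp.
apply: (@regzX (k * n.+2)); rewrite exprM.
have -> : (z ^+ k) ^+ n.+2 * p =
   (\sum_(i < n.+2) (z ^+ k) ^+ (n.+1 - i) * (- (x * y * q)) ^+ i) * (C k.+1 * p)
   + ((- (y * q)) ^+ n.+2 * p) * x ^+ n.+2.
  have := subrXX (z ^+ k) (- (x * y * q)) n.+2; rewrite opprK -Hq /= => E.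
  rewrite mulrA [_ * C k.+1]mulrC -E mulrBl [_ * p * _]mulrAC -exprMn.
  by rewrite (_ : - (y * q) * x = - (x * y * q)) ?subrK //; ring.
apply: in_powD; first exact: in_powM.
by exists ((- (y * q)) ^+ n.+2 * p), 0; rewrite mul0r addr0.
Qed.

Lemma regxyX i j a b : x ^+ i * a = y ^+ j * b -> exists c, a = y ^+ j * c.
Proof.
have reg1 l c d : x ^+ l * c = y * d -> exists e, c = y * e.
  elim: l c d => [|l IHl] c d; first by rewrite expr0 mul1r; exists d.
  rewrite exprSr -mulrA => /IHl [e /esym] H.
  by have [e' [_ He']] := regxy H; exists e'.
elim: j a b => [|j IHj] a b; first by exists a; rewrite expr0 mul1r.
rewrite exprS -mulrA => H; have [c Hc] := reg1 _ _ _ H.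
have [|c' Hc'] := IHj c b.
  by apply: (mulfI y0); rewrite -H Hc mulrCA.
by exists c'; rewrite Hc Hc' mulrA.
Qed.

Lemma mul_row2_natmx (a : 'rV[R]_2) m e (j : 'I_m) :
  (a *m natmx 2 m e) 0 j = a 0 0 * e 0%N j + a 0 1 * e 1%N j.
Proof.
rewrite mxE !big_ord_recl big_ord0 !mxE /= addr0.
by congr (_ + a _ _ * _); apply/val_inj.
Qed.

Lemma ker_syz (w : 'rV[R]_N2) :
  w *m natmx N2 N1 sz = 0 -> exists w', w = w' *m natmx 2 N2 ssz.
Proof.
move=> Hw; have [|t [m H]] := @syz_exact _ x y z n y0 regxy regyz (natrow w).
  move=> v; rewrite -hN1 -hN2 => hv.
  by rewrite -(mul_row_natmx w sz (Ordinal hv)) Hw mxE.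
exists (\row_(i < 2) if i == 0 then t else m).
apply/rowP => u; rewrite mul_row2_natmx !mxE /=.
by rewrite -natrowE H // -hN2.
Qed.

(* With d2, d3 the maps given by [syz], [ssyz]:
   if y^(n+1) w = d2 u and x^(n+2) w = d2 v, then x^(n+2) u - y^(n+1) v = d3 k';
   reading this modulo (x^(n+2), y^(n+1)) shows that k' vanishes there, so that u can
   be corrected to be divisible by y^(n+1). *)
Lemma ker_gen (w : 'rV[R]_N1) :
  \sum_(0 <= v < N1) natrow w v * gn v = 0 -> im_mx (natmx N2 N1 sz) w.
Proof.
move=> Hw.
have [u Hu] := im_of_koszul (@koszul_y _ x y z n N1 N2 hN1 hN2) Hw.
have [v Hv] := im_of_koszul (@koszul_x _ x y z n N1 N2 hN1 hN2) Hw.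
pose k := x ^+ n.+2 *: u - y ^+ n.+1 *: v.
have [|k' Hk] := @ker_syz k.
  by rewrite mulmxBl -!scalemxAl -Hu -Hv !scalerA mulrC subrr.
have Ek j (hj : (j < N2)%N) : x ^+ n.+2 * u 0 (Ordinal hj) - y ^+ n.+1 * v 0 (Ordinal hj)
    = k' 0 0 * ssz 0 j + k' 0 1 * ssz 1 j.
  have /rowP /(_ (Ordinal hj)) := Hk.
  by rewrite mul_row2_natmx !mxE.
have Pk j : (j < N2)%N -> in_pow (k' 0 0 * ssz 0 j + k' 0 1 * ssz 1 j).
  move=> hj; rewrite -(Ek j hj); exists (u 0 (Ordinal hj)), (- v 0 (Ordinal hj)).
  by ring.
have E0 : ssz 0 (n + n.+2) = y /\ ssz 1 (n + n.+2) = - C n.+2.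
  rewrite /ssyz subnn ltnn.
  have -> : (n + n.+2 < n)%N = false by lia.
  by have -> : (n + n.+2 < n + n.+1)%N = false by lia.
have E1 : ssz 0 (n + n.+2).+1 = - z /\ ssz 1 (n + n.+2).+1 = x * C n.+1.
  rewrite /ssyz subSnn.
  have -> : ((n + n.+2).+1 < n + n.+2)%N = false by lia.
  have -> : ((n + n.+2).+1 < n)%N = false by lia.
  by have -> : ((n + n.+2).+1 < n + n.+1)%N = false by lia.
have P0 : in_pow (k' 0 0 * y - k' 0 1 * C n.+2).
  by have := Pk (n + n.+2)%N; rewrite !E0.1 !E0.2 mulrN; apply; lia.
have P1 : in_pow (k' 0 1 * (x * C n.+1) - k' 0 0 * z).
  have := Pk (n + n.+2).+1; rewrite !E1.1 !E1.2 mulrN addrC; apply; lia.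
(* The columns of [ssyz] at the first two [syzC] relations form a 2 x 2 matrix of determinant
   -D_(n+2), which is regular modulo the ideal. *)
have Pm : in_pow (k' 0 1).
  apply: (@reg_cheb n.+2); rewrite chebSS.
  have -> : (z * C n.+2 - x * y * C n.+1) * k' 0 1 =
     (- z) * (k' 0 0 * y - k' 0 1 * C n.+2) + (- y) * (k' 0 1 * (x * C n.+1) - k' 0 0 * z).
    by ring.
  by apply: in_powD; apply: in_powM.
have Pt : in_pow (k' 0 0).
  apply: regz; have -> : z * k' 0 0 =
     (-1) * (k' 0 1 * (x * C n.+1) - k' 0 0 * z) + (x * C n.+1) * k' 0 1 by ring.
  by apply: in_powD; apply: in_powM.
have [a1 [b1 H1]] := Pt; have [a2 [b2 H2]] := Pm.
pose a := \row_(i < 2) if i == 0 then a1 else a2.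
pose u' := u - a *m natmx 2 N2 ssz.
have Hu' : forall j, exists c, u' 0 j = y ^+ n.+1 * c.
  move=> [j hj]; have := Ek j hj; rewrite H1 H2 => E.
  apply: (@regxyX n.+2 _ _ (v 0 (Ordinal hj) + b1 * ssz 0 j + b2 * ssz 1 j)).
  rewrite /u' mxE [X in _ + X]mxE mul_row2_natmx !mxE /=.
  apply/eqP; rewrite -subr_eq0; apply/eqP.
  transitivity (x ^+ n.+2 * u 0 (Ordinal hj) - y ^+ n.+1 * v 0 (Ordinal hj) - (
    (a1 * x ^+ n.+2 + b1 * y ^+ n.+1) * ssz 0 j +
    (a2 * x ^+ n.+2 + b2 * y ^+ n.+1) * ssz 1 j)); first by ring.
  by rewrite E subrr.
have [c Hc] := fin_all_exists Hu'.
exists (\row_j c j).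
have Ess : a *m natmx 2 N2 ssz *m natmx N2 N1 sz = 0.
  rewrite -mulmxA (_ : natmx 2 N2 ssz *m natmx N2 N1 sz = 0) ?mulmx0 //.
  apply/matrixP => i j; rewrite mxE [RHS]mxE.
  rewrite -[RHS](@ssyz_syz _ x y z n i j) -?hN1 // -hN2 big_mkord.
  by apply: eq_bigr => l _; rewrite !mxE.
apply/rowP => j; apply: (mulfI (expf_neq0 n.+1 y0)).
have /rowP /(_ j) := Hu.
rewrite mxE => ->; rewrite -[u](subrK (a *m natmx 2 N2 ssz)) mulmxDl Ess addr0 -/u'.
rewrite !mxE big_distrr /=; apply: eq_bigr => l _.
by rewrite Hc !mxE mulrA.
Qed.

(** Two columns suffice: the last one is (x, 0), and the one of the first [syzB] relation has f_0 =
    y^s in row 1. *)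
Lemma ker_ssyz (w : 'rV[R]_2) : w *m natmx 2 N2 ssz = 0 -> w = 0.
Proof.
move=> H; have E j (hj : (j < N2)%N) : w 0 0 * ssz 0 j + w 0 1 * ssz 1 j = 0.
  have /rowP /(_ (Ordinal hj)) := H.
  by rewrite mul_row2_natmx mxE.
have h2 : ((n + n.+2).+2 < N2)%N by lia.
have E2 : ssz 0 (n + n.+2).+2 = x /\ ssz 1 (n + n.+2).+2 = 0.
  rewrite /ssyz.
  have -> : ((n + n.+2).+2 - (n + n.+2) = 2)%N by lia.
  have -> : ((n + n.+2).+2 < n + n.+2)%N = false by lia.
  have -> : ((n + n.+2).+2 < n)%N = false by lia.
  by have -> : ((n + n.+2).+2 < n + n.+1)%N = false by lia.
have /eqP := E _ h2; rewrite E2.1 E2.2 mulr0 addr0 mulf_eq0 (negPf x0) orbF => /eqP t0.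
have h0 : (n < N2)%N by lia.
have En : ssz 1 n = y ^+ n.+1.
  rewrite /ssyz ltnn subnn subn0 cheb1 mulr1.
  by have -> : (n < n + n.+1)%N by lia.
have /eqP := E _ h0; rewrite t0 mul0r add0r En mulf_eq0 expf_eq0 (negPf y0) orbF => /eqP m0.
apply/rowP => i; rewrite mxE; case: i => [[|[|//]] hi].
  by rewrite -t0; congr (w _ _); apply/val_inj.
by rewrite -m0; congr (w _ _); apply/val_inj.
Qed.

End Resolution.

(** * Coordinates with respect to x^a y^b D_j *)

Section Monomials.
Import GRing.Theory.
Local Open Scope ring_scope.
Variables (k : fieldType) (n : nat).
Local Notation R := {mpoly k[n]}.
Implicit Types (p q : R) (m e : 'X_{1..n}).

Definition supp_in (Q : 'X_{1..n} -> bool) p : Prop := {in msupp p, forall m, Q m}.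

Lemma supp_in0 Q : supp_in Q 0.
Proof. by move=> m; rewrite msupp0. Qed.

Lemma supp_inD Q p q : supp_in Q p -> supp_in Q q -> supp_in Q (p + q).
Proof.
move=> Hp Hq m /msuppD_le; rewrite mem_cat => /orP[]; [exact: Hp|exact: Hq].
Qed.

Lemma supp_inZ Q c p : supp_in Q p -> supp_in Q (c *: p).
Proof. by move=> Hp m /msuppZ_le; apply: Hp. Qed.

Lemma supp_in_sum Q (I : Type) (r : seq I) (P : pred I) (F : I -> R) :
  (forall i, P i -> supp_in Q (F i)) -> supp_in Q (\sum_(i <- r | P i) F i).
Proof.
move=> HF; elim/big_rec: _ => [|i w Pi Hw]; first exact: supp_in0.
by apply: supp_inD => //; apply: HF.
Qed.

Lemma supp_inX Q m : supp_in Q 'X_[m] <-> Q m.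
Proof.
split=> [|H m']; first by apply; rewrite msuppX inE.
by rewrite msuppX inE => /eqP ->.
Qed.

Lemma supp_in_coeff Q p m : supp_in Q p -> ~~ Q m -> p@_m = 0.
Proof.
by move=> Hp /negP HQ; apply/eqP/contraT; rewrite -mcoeff_msupp => /Hp.
Qed.

Lemma supp_inXM (Q Q' : 'X_{1..n} -> bool) e p :
  (forall m, Q m -> Q' (e + m)%MM) -> supp_in Q p -> supp_in Q' ('X_[e] * p).
Proof.
move=> HQ Hp m; rewrite mulrC (perm_mem (msuppMX p e)) => /mapP[m' hm' ->].
exact/HQ/Hp.
Qed.

Lemma mcoeffXM p e m : ('X_[e] * p)@_(e + m) = p@_m.
Proof. by rewrite mulrC mcoeffMX. Qed.

Lemma mcoeffXM_eq0 p e m : ~~ (e <= m)%MM -> ('X_[e] * p)@_m = 0.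
Proof.
move=> he; apply/eqP; rewrite mcoeff_eq0; apply: contra he.
by rewrite mulrC (perm_mem (msuppMX p e)) => /mapP[m' _ ->]; apply: lem_addr.
Qed.

Lemma supp_in_dvd e p : supp_in (fun m => (e <= m)%MM) p <-> exists q, p = 'X_[e] * q.
Proof.
split=> [Hp|[q ->] m hm]; last first.
  by apply: contraTT hm => /mcoeffXM_eq0; rewrite mcoeff_msupp => ->; rewrite eqxx.
exists (\sum_(m <- msupp p) p@_m *: 'X_[m - e]).
rewrite {1}[p]mpolyE big_distrr /=; apply: eq_big_seq => m hm.
by rewrite -scalerAr -mpolyXD addmC submK //; apply: Hp.
Qed.

Lemma mpolyX_regular (i j : 'I_n) (a b : R) : i != j ->
  'X_i * a = 'X_j * b -> exists c, a = 'X_j * c /\ b = 'X_i * c.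
Proof.
move=> hij H.
have [c Hc] : exists c, a = 'X_j * c.
  apply/supp_in_dvd => m; rewrite mcoeff_msupp => hm.
  have : (U_(j) <= U_(i) + m)%MM.
    apply: contraNT hm => hj; rewrite -(mcoeffXM a U_(i)) H.
    by rewrite mcoeffXM_eq0.
  by rewrite !lep1mP mnmDE mnm1E (negPf hij).
exists c; split => //.
have nz : 'X_j != 0 :> R by rewrite -msize_poly_eq0 msizeX mdeg1.
by apply: (mulfI nz); rewrite -H Hc mulrCA.
Qed.

End Monomials.

(** * Regularity of z modulo powers of x and y *)

Section Regular.
Import GRing.Theory.
Local Open Scope ring_scope.
Variables (k : fieldType).
Local Notation R := {mpoly k[3]}.
Implicit Types (p q : R).
Local Notation i0 := (@Ordinal 3 0 isT).
Local Notation i1 := (@Ordinal 3 1 isT).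
Local Notation i2 := (@Ordinal 3 2 isT).

Lemma xv_neq0 : xv k != 0.
Proof. by rewrite -msize_poly_eq0 msizeX mdeg1. Qed.

Lemma yv_neq0 : yv k != 0.
Proof. by rewrite -msize_poly_eq0 msizeX mdeg1. Qed.

Lemma in_pow_supp i j p :
  (exists a b, p = a * xv k ^+ i + b * yv k ^+ j) <->
  supp_in (fun m => (i <= m i0)%N || (j <= m i1)%N) p.
Proof.
have mulX (h : 'I_3) l m : (U_(h) *+ l + m)%MM h = (l + m h)%N.
  by rewrite mnmDE mulmnE mnm1E eqxx mul1n.
split=> [[a [b ->]]|Hp].
  apply: supp_inD; rewrite /xv /yv mpolyXn mulrC.
    by apply: (@supp_inXM _ _ predT) => // m _; rewrite mulX leq_addr.
  by apply: (@supp_inXM _ _ predT) => // m _; rewrite mulX leq_addr orbT.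
have dvd (h : 'I_3) l q : supp_in (fun m => (l <= m h)%N) q ->
    exists a, q = a * 'X_h ^+ l.
  move=> Hq; have [|c ->] := (supp_in_dvd (U_(h) *+ l)%MM q).1; last first.
    by exists c; rewrite mpolyXn mulrC.
  move=> m /Hq hm; apply/mnm_lepP => h'; rewrite mulmnE mnm1E.
  by case: eqP => [<-|_]; rewrite ?mul1n ?mul0n.
have [|a Ha] := dvd i0 i (\sum_(m <- msupp p | (i <= m i0)%N) p@_m *: 'X_[m]).
  by apply: supp_in_sum => m hm; apply/supp_inZ/supp_inX.
have [|b Hb] := dvd i1 j (\sum_(m <- msupp p | ~~ (i <= m i0)%N) p@_m *: 'X_[m]).
  rewrite big_seq_cond; apply: supp_in_sum => m /andP[hm hi].
  by apply/supp_inZ/supp_inX; have := Hp _ hm; rewrite (negPf hi).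
exists a, b; rewrite -[xv k]/'X_i0 -[yv k]/'X_i1 -Hb -Ha [LHS]mpolyE.
by rewrite (bigID (fun m : 'X_{1..3} => (i <= m i0)%N)).
Qed.

(** The ideal (x^i, y^j) is monomial and z does not enter its description, so multiplication by z
    shifts exponents without changing membership. *)
Lemma regular_zv i j p :
  (exists a b, zv k * p = a * xv k ^+ i + b * yv k ^+ j) ->
  exists a b, p = a * xv k ^+ i + b * yv k ^+ j.
Proof.
move=> /in_pow_supp H; apply/in_pow_supp => m; rewrite mcoeff_msupp => hm.
have : (U_(i2) + m)%MM \in msupp (zv k * p) by rewrite mcoeff_msupp mcoeffXM.
by move/H; rewrite !mnmDE !mnm1E.
Qed.

End Regular.

Section LinearExtension.
Import GRing.Theory.
Local Open Scope ring_scope.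
Variables (k : fieldType) (n : nat).
Local Notation R := {mpoly k[n]}.

Definition lin_ext (F : 'X_{1..n} -> R) (p : R) : R :=
  \sum_(m <- msupp p) p@_m *: F m.

Lemma lin_extE F p (r : seq 'X_{1..n}) : uniq r -> {subset msupp p <= r} ->
  lin_ext F p = \sum_(m <- r) p@_m *: F m.
Proof.
move=> ur sr; rewrite /lin_ext [RHS](bigID (mem (msupp p))) /= [X in _ + X]big1 ?addr0.
  rewrite -[RHS]big_filter; apply/perm_big/uniq_perm.
  - exact: msupp_uniq.
  - exact: filter_uniq.
  by move=> m; rewrite mem_filter; case: (boolP (m \in msupp p)) => [/sr ->|].
by move=> m /memN_msupp_eq0 ->; rewrite scale0r.
Qed.

Lemma lin_ext_is_linear F : linear (lin_ext F).
Proof.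
move=> c p q; pose r := undup (msupp p ++ msupp q).
have ur : uniq r by apply: undup_uniq.
rewrite (@lin_extE F (c *: p + q) r) // => [|m]; last first.
  rewrite mem_undup mem_cat => /msuppD_le; rewrite mem_cat => /orP[/msuppZ_le ->|->] //.
  by rewrite orbT.
rewrite (@lin_extE F p r) // => [|m hm]; last by rewrite mem_undup mem_cat hm.
rewrite (@lin_extE F q r) // => [|m hm]; last by rewrite mem_undup mem_cat hm orbT.
rewrite scaler_sumr -big_split /=; apply: eq_bigr => m _.
by rewrite mcoeffD mcoeffZ scalerDl scalerA.
Qed.

HB.instance Definition _ F :=
  GRing.isLinear.Build k R R _ (lin_ext F) (lin_ext_is_linear F).

Lemma lin_extX F m : lin_ext F 'X_[m] = F m.
Proof. by rewrite /lin_ext msuppX big_seq1 mcoeffX eqxx scale1r. Qed.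

Lemma linear_mpoly_ext (f g : R -> R) : linear f -> linear g ->
  (forall m, f 'X_[m] = g 'X_[m]) -> f =1 g.
Proof.
move=> lf lg H p.
have [f0 g0] : f 0 = 0 /\ g 0 = 0.
  by have := lf (-1) 0 0; have := lg (-1) 0 0; rewrite !scaler0 !addr0 !scaleN1r !addNr.
elim/mpolyind: p => [|c m p _ _ IHp]; first by rewrite f0 g0.
by rewrite lf lg H IHp.
Qed.

Lemma linear_mull (c : R) : linear (fun p : R => c * p).
Proof. by move=> a p q; rewrite mulrDr scalerAr. Qed.

Lemma linear_comp (f g : R -> R) : linear f -> linear g -> linear (fun p => f (g p)).
Proof. by move=> lf lg a p q; rewrite lg lf. Qed.

Lemma supp_in_lin_ext (Q Q' : 'X_{1..n} -> bool) F p :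
  (forall m, Q m -> supp_in Q' (F m)) -> supp_in Q p -> supp_in Q' (lin_ext F p).
Proof.
move=> HF Hp; rewrite /lin_ext big_seq_cond; apply: supp_in_sum => m /andP[hm _].
exact/supp_inZ/HF/Hp.
Qed.

End LinearExtension.

(** * The change of basis and its inverse *)

Section Coordinates.
Import GRing.Theory.
Local Open Scope ring_scope.
Variables (k : fieldType).
Local Notation R := {mpoly k[3]}.
Implicit Types (p q : R) (m : 'X_{1..3}).
Local Notation i0 := (@Ordinal 3 0 isT).
Local Notation i1 := (@Ordinal 3 1 isT).
Local Notation i2 := (@Ordinal 3 2 isT).
Local Notation x := (xv k).
Local Notation y := (yv k).
Local Notation z := (zv k).
Local Notation C := (cheb x y z).

Lemma mnm3P m m' : m i0 = m' i0 -> m i1 = m' i1 -> m i2 = m' i2 -> m = m'.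
Proof.
move=> h0 h1 h2; apply/mnmP => -[[|[|[|//]]] hi].
- by rewrite (_ : Ordinal hi = i0) //; apply/val_inj.
- by rewrite (_ : Ordinal hi = i1) //; apply/val_inj.
- by rewrite (_ : Ordinal hi = i2) //; apply/val_inj.
Qed.

Lemma mdeg3 m : mdeg m = (m i0 + m i1 + m i2)%N.
Proof.
rewrite mdegE !big_ord_recl big_ord0 addn0 addnA.
by congr (m _ + m _ + m _)%N; apply/val_inj.
Qed.

Lemma mpolyX3 m : 'X_[m] = x ^+ m i0 * y ^+ m i1 * z ^+ m i2 :> R.
Proof.
rewrite mpolyXE_id !big_ord_recl big_ord0 mulr1 mulrA.
by congr ('X_ _ ^+ m _ * 'X_ _ ^+ m _ * 'X_ _ ^+ m _); apply/val_inj.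
Qed.

Definition mnm3 (a b j : nat) : 'X_{1..3} := [multinom nth 0%N [:: a; b; j] i | i < 3].

Lemma mnm3E a b j : (mnm3 a b j i0 = a) * (mnm3 a b j i1 = b) * (mnm3 a b j i2 = j).
Proof. by rewrite !mnmE. Qed.

Definition cheb_mon m : R := x ^+ m i0 * y ^+ m i1 * C (m i2).+1.

(** Coordinates are themselves stored as a polynomial, whose monomial x^a y^b z^j stands for x^a y^b
    D_j. *)
Definition from_coord : R -> R := lin_ext cheb_mon.
HB.instance Definition _ := GRing.Linear.on from_coord.

(* z D_j = D_(j+1) + x y D_(j-1) *)
Definition zmul_mon m : R :=
  'X_[U_(i2) + m] + (if (0 < m i2)%N then 'X_[U_(i0) + U_(i1) + (m - U_(i2))] else 0).

Definition zmul : R -> R := lin_ext zmul_mon.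
HB.instance Definition _ := GRing.Linear.on zmul.

(** As D_0 = 1, the coordinates of z^j come from 1 by j multiplications by z carried out in
    coordinates; this replaces a closed formula for z^j in the D_i. *)
Definition cheb_coord_mon m : R := x ^+ m i0 * y ^+ m i1 * iter (m i2) zmul 1.

Definition cheb_coord : R -> R := lin_ext cheb_coord_mon.
HB.instance Definition _ := GRing.Linear.on cheb_coord.

Lemma zmulX a b j : zmul (x ^+ a * y ^+ b * z ^+ j.+1) =
  x ^+ a * y ^+ b * z ^+ j.+2 + x ^+ a.+1 * y ^+ b.+1 * z ^+ j.
Proof.
have -> : x ^+ a * y ^+ b * z ^+ j.+1 = 'X_[mnm3 a b j.+1] by rewrite mpolyX3 !mnm3E.
rewrite /zmul lin_extX /zmul_mon mnm3E /= !mpolyX3 !(mnmDE, mnmBE, mnm1E) !mnm3E /=.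
by rewrite !add0n !add1n subn1 !subn0.
Qed.

Lemma zmulX0 a b : zmul (x ^+ a * y ^+ b) = x ^+ a * y ^+ b * z.
Proof.
have -> : x ^+ a * y ^+ b = 'X_[mnm3 a b 0] by rewrite mpolyX3 !mnm3E mulr1.
rewrite /zmul lin_extX /zmul_mon mnm3E /= addr0 !mpolyX3 !(mnmDE, mnmBE, mnm1E) !mnm3E /=.
by rewrite !add0n expr1 expr0 mulr1.
Qed.

Lemma cheb_monX a b j : from_coord (x ^+ a * y ^+ b * z ^+ j) = x ^+ a * y ^+ b * C j.+1.
Proof.
have -> : x ^+ a * y ^+ b * z ^+ j = 'X_[mnm3 a b j] by rewrite mpolyX3 !mnm3E.
by rewrite /from_coord lin_extX /cheb_mon !mnm3E.
Qed.

Lemma coord_monX a b j : cheb_coord (x ^+ a * y ^+ b * z ^+ j) = x ^+ a * y ^+ b * iter j zmul 1.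
Proof.
have -> : x ^+ a * y ^+ b * z ^+ j = 'X_[mnm3 a b j] by rewrite mpolyX3 !mnm3E.
by rewrite /cheb_coord lin_extX /cheb_coord_mon !mnm3E.
Qed.

Lemma mpoly3_linear_ext (f g : R -> R) : linear f -> linear g ->
  (forall a b j, f (x ^+ a * y ^+ b * z ^+ j) = g (x ^+ a * y ^+ b * z ^+ j)) -> f =1 g.
Proof. by move=> lf lg H; apply: linear_mpoly_ext => // m; rewrite mpolyX3. Qed.

Lemma zmul_xy a b p : zmul (x ^+ a * y ^+ b * p) = x ^+ a * y ^+ b * zmul p.
Proof.
apply: (@mpoly3_linear_ext (fun p => zmul ((x ^+ a * y ^+ b) * p)) (fun p => (x ^+ a * y ^+ b) * (zmul p))) p; try by do 2?[exact: lin_ext_is_linear | exact: linear_mull | apply: linear_comp].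
move=> a' b' [|j] /=.
  rewrite expr0 mulr1 zmulX0.
  by rewrite (_ : _ * _ = x ^+ (a + a') * y ^+ (b + b')) ?zmulX0 !exprD; ring.
rewrite zmulX (_ : _ * _ = x ^+ (a + a') * y ^+ (b + b') * z ^+ j.+1); last first.
  by rewrite !exprD; ring.
by rewrite zmulX -!addnS !exprD; ring.
Qed.

Lemma from_coord_z p : from_coord (zmul p) = z * from_coord p.
Proof.
apply: (@mpoly3_linear_ext (fun p => from_coord (zmul p)) (fun p => z * (from_coord p))) p; try by do 2?[exact: lin_ext_is_linear | exact: linear_mull | apply: linear_comp].
move => a b j /=.
case: j => [|j].
  rewrite expr0 mulr1 zmulX0 -[X in _ * X]expr1 cheb_monX.
  rewrite -[X in from_coord X]mulr1 -(expr0 z) cheb_monX chebSS cheb1 cheb0; ring.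
by rewrite zmulX linearD /= !cheb_monX (chebSS _ _ _ j.+1) !exprS; ring.
Qed.

Lemma from_coord_xy a b p : from_coord (x ^+ a * y ^+ b * p) = x ^+ a * y ^+ b * from_coord p.
Proof.
apply: (@mpoly3_linear_ext (fun p => from_coord ((x ^+ a * y ^+ b) * p)) (fun p => (x ^+ a * y ^+ b) * (from_coord p))) p; try by do 2?[exact: lin_ext_is_linear | exact: linear_mull | apply: linear_comp].
move=> a' b' j /=; rewrite (_ : _ * _ = x ^+ (a + a') * y ^+ (b + b') * z ^+ j).
  by rewrite !cheb_monX !exprD; ring.
by rewrite !exprD; ring.
Qed.

Lemma cheb_coord_z p : cheb_coord (z * p) = zmul (cheb_coord p).
Proof.
apply: (@mpoly3_linear_ext (fun p => cheb_coord (z * p)) (fun p => zmul (cheb_coord p))) p; try by do 2?[exact: lin_ext_is_linear | exact: linear_mull | apply: linear_comp].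
move => a b j /=.
rewrite mulrCA -exprS !coord_monX zmul_xy //.
Qed.

Lemma cheb_coord_xy a b p : cheb_coord (x ^+ a * y ^+ b * p) = x ^+ a * y ^+ b * cheb_coord p.
Proof.
apply: (@mpoly3_linear_ext (fun p => cheb_coord ((x ^+ a * y ^+ b) * p)) (fun p => (x ^+ a * y ^+ b) * (cheb_coord p))) p; try by do 2?[exact: lin_ext_is_linear | exact: linear_mull | apply: linear_comp].
move=> a' b' j /=; rewrite (_ : _ * _ = x ^+ (a + a') * y ^+ (b + b') * z ^+ j).
  by rewrite !coord_monX !exprD; ring.
by rewrite !exprD; ring.
Qed.

Lemma cheb_coord_x p : cheb_coord (x * p) = x * cheb_coord p.
Proof. by have := cheb_coord_xy 1 0 p; rewrite expr0 expr1 mulr1. Qed.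

Lemma cheb_coord_y p : cheb_coord (y * p) = y * cheb_coord p.
Proof. by have := cheb_coord_xy 0 1 p; rewrite expr0 expr1 mul1r. Qed.

Lemma cheb_coord1 : cheb_coord 1 = 1.
Proof. by have := coord_monX 0 0 0; rewrite !expr0 !mulr1. Qed.

(** The extra term x y z^(j-1) that [zmul] adds to z^(j+1) is the one that the recurrence of the D_j
    subtracts. *)
Lemma cheb_coord_cheb j : cheb_coord (C j.+1) = z ^+ j.
Proof.
elim/ltn_ind: j => [[|[|j]]] IHj.
- by rewrite cheb1 cheb_coord1.
- rewrite chebSS cheb1 cheb0 mulr0 subr0 cheb_coord_z cheb_coord1.
  by have := zmulX0 0 0; rewrite !expr0 !mul1r.
rewrite chebSS linearB /= cheb_coord_z IHj // -mulrA cheb_coord_x cheb_coord_y IHj //.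
have := zmulX 0 0 j; rewrite !expr0 !expr1 !mul1r => ->.
by rewrite mulrA addrK.
Qed.

(** [from_coord] turns [zmul] into multiplication by z and commutes with x and y, so the check
    reduces to 1. This is the spanning half of the basis property; independence is
    [cheb_coord_cheb_mon]. *)
Lemma cheb_coordK : cancel cheb_coord from_coord.
Proof.
move=> p.
apply: (@mpoly3_linear_ext (fun p => from_coord (cheb_coord p)) (fun p => p)) p; try by do 2?[exact: lin_ext_is_linear | exact: linear_mull | apply: linear_comp].
move => a b j /=.
rewrite coord_monX from_coord_xy; congr (_ * _).
elim: j => [|j IHj]; last by rewrite iterS from_coord_z IHj exprS.
by have := cheb_monX 0 0 0; rewrite !expr0 cheb1 !mulr1.
Qed.

Lemma cheb_coord_sum (I : Type) (r : seq I) (P : pred I) (F : I -> R) :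
  cheb_coord (\sum_(i <- r | P i) F i) = \sum_(i <- r | P i) cheb_coord (F i).
Proof. exact: (linear_sum (GRing.Linear.clone _ _ _ _ cheb_coord _)). Qed.

Lemma cheb_coordZ c p : cheb_coord (c *: p) = c *: cheb_coord p.
Proof. by rewrite linearZ. Qed.

Lemma cheb_coord_cheb_mon m : cheb_coord (cheb_mon m) = 'X_[m].
Proof. by rewrite /cheb_mon cheb_coord_xy cheb_coord_cheb mpolyX3. Qed.

Lemma cheb_mon_sum p : p = \sum_(m <- msupp (cheb_coord p)) (cheb_coord p)@_m *: cheb_mon m.
Proof. by rewrite -[LHS]cheb_coordK. Qed.

Lemma dhomog_supp d p : (p \is d.-homog) <-> supp_in (fun m => mdeg m == d) p.
Proof.
split=> [/dhomogP H m /H /= -> //|H]; apply/dhomogP => m /H /eqP.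
by [].
Qed.

Lemma zmul_supp d p : supp_in (fun m => mdeg m == d) p ->
  supp_in (fun m => mdeg m == d.+1) (zmul p).
Proof.
apply: supp_in_lin_ext => m /eqP <-; apply: supp_inD.
  by apply/supp_inX; rewrite mdegD mdeg1.
case: ltnP => h; last exact: supp_in0.
apply/supp_inX; rewrite !mdegD !mdeg1 !mdeg3 !mnmBE !mnm1E /= !subn0.
by apply/eqP; lia.
Qed.

Lemma xy_supp a b d p : supp_in (fun m => mdeg m == d) p ->
  supp_in (fun m => mdeg m == (a + b + d)%N) (x ^+ a * y ^+ b * p).
Proof.
have -> : x ^+ a * y ^+ b = 'X_[mnm3 a b 0] by rewrite mpolyX3 !mnm3E mulr1.
apply: supp_inXM => m /eqP <-; rewrite mdegD.
by rewrite mdeg3 !mnm3E addn0.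
Qed.

Lemma dhomog_var i : ('X_i : R) \is 1.-homog.
Proof. by rewrite dhomogX; apply/eqP/mdeg1. Qed.

Lemma dhomog_cheb j : C j.+1 \is j.-homog.
Proof.
elim/ltn_ind: j => [[|[|j]]] IHj.
- by rewrite cheb1 dhomog1.
- by rewrite chebSS cheb1 cheb0 mulr0 subr0 mulr1 dhomog_var.
rewrite chebSS; apply: rpredB.
  by apply: (@dhomogM _ _ _ 1%N _ j.+1); [exact: dhomog_var | exact: IHj].
apply: (@dhomogM _ _ _ 2%N _ j); last exact: IHj.
by apply: (@dhomogM _ _ _ 1%N _ 1%N); exact: dhomog_var.
Qed.

Lemma dhomog_cheb_mon m : cheb_mon m \is (mdeg m).-homog.
Proof.
apply/dhomog_supp; rewrite mdeg3; apply: xy_supp.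
exact/dhomog_supp/dhomog_cheb.
Qed.

(** D_j is homogeneous of degree j, as z^j is, so a coordinate monomial has the degree of the basis
    element it stands for. *)
Lemma dhomog_coord d p : (p \is d.-homog) <-> supp_in (fun m => mdeg m == d) (cheb_coord p).
Proof.
split=> [/dhomog_supp|H].
  apply: supp_in_lin_ext => m /eqP <-; rewrite mdeg3; apply: xy_supp.
  elim: (m i2) => [|j IHj] /=; last exact: zmul_supp.
  by rewrite /= -mpolyX0; apply/supp_inX; rewrite mdeg0.
rewrite [p]cheb_mon_sum big_seq_cond; apply: rpred_sum => m /andP[hm _].
by apply: rpredZ; rewrite -(eqP (H _ hm)) dhomog_cheb_mon.
Qed.

End Coordinates.

(** * The Pfaffians of V *)

Section Pfaffian.
Import GRing.Theory.
Local Open Scope ring_scope.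
Variable R : comNzRingType.

Fixpoint natpf (n : nat) (A : nat -> nat -> R) : R :=
  match n with
  | 0 => 1
  | 1 => 0
  | n'.+2 => \sum_(j < n'.+1) (-1) ^+ j * A 0%N j.+1 *
               natpf n' (fun u v => A (bump j u).+1 (bump j v).+1)
  end.

Lemma pf_natmx n (A : nat -> nat -> R) : pf (natmx n n A) = natpf n A.
Proof.
elim/ltn_ind: n A => [[|[|n]]] IHn A //=.
apply: eq_bigr => j _; rewrite mxE -IHn //; congr (_ * pf _).
by apply/matrixP => u v; rewrite !mxE.
Qed.

(** The last b vertices carry no edge among themselves and outnumber the other a, so there is no
    perfect matching. *)
Lemma natpf_gt a b (A : nat -> nat -> R) : (a < b)%N ->
  (forall u v, (a <= u)%N -> (a <= v)%N -> A u v = 0) -> natpf (a + b) A = 0.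
Proof.
elim/ltn_ind: a b A => [[|a]] IHa b A hab HA.
  rewrite add0n; case: b hab => [|[|b]] _ //=.
  by rewrite big1 // => j _; rewrite HA // mulr0 mul0r.
have -> : (a.+1 + b = (a + b.-1).+2)%N by lia.
rewrite /= big1 // => -[j hj'] _ /=.
have [hj|hj] := ltnP j a.
  rewrite [X in _ * X](_ : _ = 0) ?mulr0 //.
  have -> : (a + b.-1 = a.-1 + b)%N by lia.
  apply: IHa; [lia | lia |] => u v hu hv.
  by apply: HA; rewrite /bump; lia.
rewrite [X in _ * X](_ : _ = 0) ?mulr0 //.
apply: IHa => //; first lia.
by move=> u v hu hv; apply: HA; rewrite /bump; lia.
Qed.

(* A perfect matching of two classes of [n] vertices, one of which carries no
   edge, matches each class with the other one. *)
Lemma natpf_bipartite n (A : nat -> nat -> R) :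
  (forall u v, (u < n)%N -> (v < n)%N -> A u v = 0) \/
  (forall u v, (n <= u)%N -> (n <= v)%N -> A u v = 0) ->
  natpf (n + n) A = (-1) ^+ 'C(n, 2) * \det (natmx n n (fun u v => A u (n + v)%N)).
Proof.
elim: n A => [|n IHn] A HA; first by rewrite /= det_mx00 mulr1.
have -> : (n.+1 + n.+1 = (n + n).+2)%N by lia.
rewrite /= (expand_det_row _ ord0) -addnS big_split_ord /= big1 ?add0r; last first.
  (* Matching vertex 0 within its own class contributes nothing: either the entry is 0, or the n - 1
     vertices left there cannot absorb the n + 1 edgeless ones. *)
  move=> [j hj] _ /=; case: HA => HA; first by rewrite HA ?ltnS // mulr0 mul0r.
  rewrite [X in _ * X](_ : _ = 0) ?mulr0 //.
  have -> : (n + n = n.-1 + n.+1)%N by lia.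
  apply: natpf_gt; first lia.
  by move=> u v hu hv; apply: HA; rewrite /bump; lia.
rewrite big_distrr /=; apply: eq_bigr => j _.
rewrite IHn; last first.
  case: HA => HA; [left|right] => u v hu hv; apply: HA; rewrite /bump; lia.
(* The partner of index n + j has sign (-1)^n times that of column j in the determinant; these
   factors accumulate to the exponent 'C(n, 2). *)
rewrite /cofactor mxE binS bin1 addSn.
have -> : natmx n n (fun u v => A (bump (n + j) u).+1 (bump (n + j) (n + v)).+1) =
    row' ord0 (col' j (natmx n.+1 n.+1 (fun u v => A u (n.+1 + v)%N))).
  apply/matrixP => u v; rewrite !mxE /=; have /= hu := ltn_ord u.
  by congr (A _ _); rewrite /bump; lia.
rewrite add0n !exprD.
set d := \det _; set a := A _ _.
by ring.
Qed.

End Pfaffian.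

Section Signs.
Import GRing.Theory.
Local Open Scope ring_scope.
Variable R : comNzRingType.

Definition eq_sign (p q : R) := exists b : nat, p = (-1) ^+ b * q.

Lemma eq_sign_refl p : eq_sign p p.
Proof. by exists 0%N; rewrite mul1r. Qed.

Lemma eq_sign_trans p q r : eq_sign p q -> eq_sign q r -> eq_sign p r.
Proof. by move=> [a ->] [b ->]; exists (a + b)%N; rewrite exprD mulrA. Qed.

Lemma eq_sign_sym p q : eq_sign p q -> eq_sign q p.
Proof. by move=> [a ->]; exists a; rewrite signrMK. Qed.

Lemma eq_signM p q p' q' : eq_sign p q -> eq_sign p' q' -> eq_sign (p * p') (q * q').
Proof. by move=> [a ->] [b ->]; exists (a + b)%N; rewrite exprD; ring. Qed.

Lemma eq_sign_signl b p : eq_sign ((-1) ^+ b * p) p.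
Proof. by exists b. Qed.

End Signs.

(** * Determinant and adjugate of U *)

Section PfaffiansV.
Import GRing.Theory.
Local Open Scope ring_scope.
Variables (k : fieldType).
Local Notation R := {mpoly k[3]}.
Local Notation x := (xv k).
Local Notation y := (yv k).
Local Notation z := (zv k).
Local Notation C := (cheb x y z).

Lemma cheb_neq0 j : C j.+1 != 0.
Proof.
apply/eqP => /(congr1 (@cheb_coord k)); rewrite cheb_coord_cheb linear0.
by apply/eqP; rewrite expf_neq0 // -msize_poly_eq0 msizeX mdeg1.
Qed.

Definition Uent (s i j : nat) : R :=
  if (i.+1 + j.+1 == s)%N then x
  else if (i.+1 + j.+1 == s.+1)%N then z
  else if (i.+1 + j.+1 == s.+2)%N then y else 0.

Lemma UmxE s : Umx k s = natmx s s (Uent s).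
Proof. by apply/matrixP => i j; rewrite !mxE. Qed.

Lemma UentC s i j : Uent s i j = Uent s j i.
Proof. by rewrite /Uent addnC. Qed.

Lemma sum_Uent n (f : nat -> R) i : (i <= n)%N ->
  \sum_(j < n.+1) Uent n.+1 i j * f j =
  (if (i < n)%N then x * f (n.-1 - i)%N else 0) + z * f (n - i)%N
  + (if (0 < i)%N then y * f (n.+1 - i)%N else 0).
Proof.
move=> hi.
transitivity (\sum_(0 <= j < n.+1) f j * ((if (i < n)%N then x else 0) * (j == n.-1 - i)%N%:R)
   + \sum_(0 <= j < n.+1) f j * (z * (j == n - i)%N%:R)
   + \sum_(0 <= j < n.+1) f j * ((if (0 < i)%N then y else 0) * (j == n.+1 - i)%N%:R)).
  rewrite -!big_split big_mkord /=; apply: eq_bigr => j _.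
  rewrite -!mulrDr mulrC; congr (_ * _); rewrite /Uent.
  move: (nat_of_ord j) (ltn_ord j) => {}j hj.
  case: eqP => h1.
    have -> : (i < n)%N by lia.
    have -> : (j == n.-1 - i)%N by lia.
    have -> : (j == n - i)%N = false by lia.
    have -> : (j == n.+1 - i)%N = false by lia.
    by rewrite /= !mulr0 !addr0 mulr1.
  have -> : (if (i < n)%N then x else 0) * (j == n.-1 - i)%N%:R = 0.
    case: ifP => hin; last by rewrite mul0r.
    have -> : (j == n.-1 - i)%N = false by lia.
    by rewrite mulr0.
  rewrite add0r; case: eqP => h2.
    have -> : (j == n - i)%N by lia.
    have -> : (j == n.+1 - i)%N = false by lia.
    by rewrite /= !mulr0 !addr0 mulr1.
  have -> : (j == n - i)%N = false by lia.
  rewrite mulr0 add0r; case: eqP => h3.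
    have -> : (j == n.+1 - i)%N by lia.
    have -> : (0 < i)%N by lia.
    by rewrite mulr1.
  case: ifP => hi0; last by rewrite mul0r.
  have -> : (j == n.+1 - i)%N = false by lia.
  by rewrite mulr0.
rewrite !sum_nat_delta; congr (_ + _ + _).
- have -> : (n.-1 - i < n.+1)%N by lia.
  by case: ifP; rewrite ?mul0r.
- by have -> : (n - i < n.+1)%N by lia.
- have -> : (n.+1 - i < n.+1)%N = (0 < i)%N by lia.
  by case: (0 < i)%N.
Qed.

(* Up to sign, the first column and the last row of the adjugate of U. *)
Definition Usol1 n j : R := (-1) ^+ j * (y ^+ (n - j) * C j.+1).
Definition Usoln n j : R := (-1) ^+ j * (x ^+ j * C (n.+1 - j)).

(** Row i gives, up to sign and the factor y^i, the recurrence that expresses D_(n+1-i). It vanishes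
    except in row 0, where U has no y-entry and D_(n+1) remains. In [UsolnP] it is the missing
    x-entry of row n. *)
Lemma Usol1P n i : (i <= n)%N -> \sum_(j < n.+1) Uent n.+1 i j * Usol1 n j =
  if i == 0%N then (-1) ^+ n * C n.+2 else 0.
Proof.
move=> hi; rewrite sum_Uent // /Usol1.
case: i hi => [|i] hi.
  rewrite /= addr0 !subn0 subnn chebSS; case: (n) => [|m] /=.
    by rewrite cheb1 cheb0; ring.
  by rewrite subSnn !exprS; ring.
rewrite /= subSS; have E : (n - i = (n - i.+1).+1)%N by lia.
have E' : (n - (n - i) = i)%N by lia.
have E'' : (n - (n - i.+1) = i.+1)%N by lia.
rewrite E' E'' E chebSS; case: ltnP => hin.
  have -> : (n.-1 - i.+1 = (n - i.+1).-1)%N by lia.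
  have -> : (n - (n - i.+1).-1 = i.+2)%N by lia.
  have [m ->] : exists m, (n - i.+1 = m.+1)%N by exists (n - i.+1).-1; lia.
  by rewrite /= !exprS; ring.
have -> : (n - i.+1 = 0)%N by lia.
by rewrite cheb0 cheb1 !exprS; ring.
Qed.

Lemma UsolnP n i : (i <= n)%N -> \sum_(j < n.+1) Uent n.+1 i j * Usoln n j =
  if i == n then C n.+2 else 0.
Proof.
move=> hi; rewrite sum_Uent // /Usoln.
have [hin|hin|->] := ltngtP i n; [| lia |]; last first.
  rewrite subnn subn0 subSnn chebSS add0r; case: (n) => [|m] /=.
    by rewrite cheb1 cheb0; ring.
  by rewrite !subSS subn0; ring.
have [m Em] : exists m, (n - i = m.+1)%N by exists (n - i).-1; lia.
have -> : (n.-1 - i = m)%N by lia.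
have -> : (n.+1 - i = m.+2)%N by lia.
rewrite Em; have -> : (n.+1 - m = i.+2)%N by lia.
have -> : (n.+1 - m.+1 = i.+1)%N by lia.
have -> : (n.+1 - m.+2 = i)%N by lia.
rewrite chebSS !exprS; case: i {hi hin Em} => [|i] /=; first by rewrite cheb0; ring.
by ring.
Qed.

Lemma row0_colmax_Umx n :
  row' ord0 (col' ord_max (Umx k n.+1)) = Umx k n.
Proof.
apply/matrixP => i j; rewrite !mxE /= /bump leq0n leqNgt ltn_ord add1n add0n.
by rewrite !addSn !eqSS.
Qed.

(** With v the vector of [Usol1], the last coordinate of adj(U) U v = det(U) v reads, up to sign,
    D_(n+1) det(U_n) = det(U_(n+1)) D_n; by induction D_n cancels. *)
Lemma det_Umx s : eq_sign (\det (Umx k s)) (C s.+1).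
Proof.
elim: s => [|n IHn]; first by rewrite det_mx00; exists 0%N; rewrite cheb1 mulr1.
set U := Umx k n.+1.
have HV : U *m (\col_j Usol1 n j) = ((-1) ^+ n * C n.+2) *: delta_mx ord0 0.
  apply/colP => i; rewrite mxE -[n.+1]/(n.+1) !mxE.
  under eq_bigr do rewrite /U UmxE !mxE.
  rewrite Usol1P ?(ltnSE (ltn_ord i)) // eqxx andbT -[i == ord0]/(i == 0%N :> nat).
  by case: eqP => _; rewrite ?mulr1 ?mulr0.
have := congr1 (mulmx (\adj U)) HV.
rewrite mulmxA mul_adj_mx mul_scalar_mx -scalemxAr => /colP /(_ ord_max).
rewrite mxE mxE [RHS]mxE -colE mxE mxE /= /Usol1 subnn mul1r.
have -> : cofactor U ord0 ord_max = (-1) ^+ n * \det (Umx k n).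
  by rewrite /cofactor row0_colmax_Umx add0n.
have [b ->] := IHn => H; exists (n + b)%N; rewrite exprD.
have ee : (-1) ^+ n * (-1) ^+ n = 1 :> R by rewrite -expr2 sqrr_sign.
apply: (mulIf (cheb_neq0 n)); move: H ee; set e := (-1) ^+ n => H ee.
transitivity ((e * e) * (\det U * C n.+1)); first by rewrite ee mul1r.
transitivity (e * (\det U * (e * C n.+1))); first by ring.
transitivity ((e * e) * (e * (-1) ^+ b * C n.+2 * C n.+1)).
  by rewrite H; ring.
by rewrite ee mul1r.
Qed.

(** All coordinates of the same identity, now with det(U) = D_(n+1), up to sign, cancelled. *)
Lemma adj_Umx_first n (i : 'I_n.+1) :
  eq_sign ((\adj (Umx k n.+1)) i ord0) (y ^+ (n - i) * C i.+1).
Proof.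
set U := Umx k n.+1.
have HV : U *m (\col_j Usol1 n j) = ((-1) ^+ n * C n.+2) *: delta_mx ord0 0.
  apply/colP => j; rewrite !mxE.
  under eq_bigr do rewrite /U UmxE !mxE.
  rewrite Usol1P ?(ltnSE (ltn_ord j)) // eqxx andbT -[j == ord0]/(j == 0%N :> nat).
  by case: eqP => _; rewrite ?mulr1 ?mulr0.
have := congr1 (mulmx (\adj U)) HV.
rewrite mulmxA mul_adj_mx mul_scalar_mx -scalemxAr => /colP /(_ i).
rewrite mxE mxE [RHS]mxE -colE mxE; have [b ->] := det_Umx n.+1.
rewrite /Usol1 => H; exists (b + i + n)%N.
apply: (mulIf (cheb_neq0 n.+1)); rewrite !exprD.
have ee : (-1) ^+ n * (-1) ^+ n = 1 :> R by rewrite -expr2 sqrr_sign.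
move: H ee; set a := (\adj U) i ord0; set e := (-1) ^+ n => H ee.
transitivity ((e * e) * (a * C n.+2)); first by rewrite ee mul1r.
transitivity (e * (e * C n.+2 * a)); first by ring.
by rewrite -H; ring.
Qed.

Lemma adj_Umx_last n (i : 'I_n.+1) :
  eq_sign ((\adj (Umx k n.+1)) ord_max i) (x ^+ i * C (n.+1 - i)).
Proof.
set U := Umx k n.+1.
have HV : (\row_j Usoln n j) *m U = C n.+2 *: delta_mx 0 ord_max.
  apply/rowP => j; rewrite !mxE.
  under eq_bigr do rewrite /U UmxE !mxE UentC mulrC.
  rewrite UsolnP ?(ltnSE (ltn_ord j)) // eqxx -[j == ord_max]/(j == n :> nat).
  by case: eqP => _; rewrite ?mulr1 ?mulr0.
have := congr1 (mulmx^~ (\adj U)) HV.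
rewrite /= -mulmxA mul_mx_adj mul_mx_scalar -scalemxAl => /rowP /(_ i).
rewrite mxE mxE [RHS]mxE -rowE mxE; have [b ->] := det_Umx n.+1.
rewrite /Usoln => H; exists (b + i)%N.
apply: (mulIf (cheb_neq0 n.+1)); rewrite !exprD [LHS]mulrC -H; ring.
Qed.

End PfaffiansV.

(** * The submaximal Pfaffians of V as determinants *)

Section MinorsV.
Import GRing.Theory.
Local Open Scope ring_scope.
Variables (k : fieldType).
Local Notation R := {mpoly k[3]}.
Local Notation x := (xv k).
Local Notation y := (yv k).
Local Notation z := (zv k).
Local Notation C := (cheb x y z).

Definition Vent (s u v : nat) : R :=
  if (u < s)%N then
    if (v < s)%N then 0
    else if v == s then (if u.+1 == s then x ^+ 2 else 0)
    else Uent k s (v - s.+1) u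
  else if u == s then
    if (v < s)%N then - (if v.+1 == s then x ^+ 2 else 0)
    else if v == s then 0 else (if (v - s.+1)%N == 0%N then y else 0)
  else
    if (v < s)%N then - Uent k s (u - s.+1) v
    else if v == s then - (if (u - s.+1)%N == 0%N then y else 0) else 0.

Lemma VmxE s : Vmx k s = natmx _ _ (Vent s).
Proof.
have lt1 (i : 'I_s) : (s + (1 + i) < s)%N = false by lia.
have eq1 (i : 'I_s) : (s + (1 + i) == s)%N = false by lia.
have sub1 (i : 'I_s) : (s + (1 + i) - s.+1 = i)%N by lia.
apply/matrixP => i j; rewrite [RHS]mxE /Vent /Vmx.
case: (split_ordP i) => {}i ->; case: (split_ordP j) => {}j -> /=;
  rewrite ?ltn_ord.
- by rewrite block_mxEul mxE.
- rewrite block_mxEur; case: (split_ordP j) => {}j -> /=.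
    by rewrite row_mxEl mxE ord1 addn0 ?ltnn ?eqxx.
  by rewrite row_mxEr ?lt1 ?eq1 ?sub1 mxE UmxE mxE.
- rewrite block_mxEdl; case: (split_ordP i) => {}i -> /=.
    by rewrite col_mxEu !mxE ord1 addn0 ?ltnn ?eqxx.
  by rewrite col_mxEd ?lt1 ?eq1 ?sub1 mxE UmxE mxE.
rewrite block_mxEdr; case: (split_ordP i) => {}i ->; case: (split_ordP j) => {}j -> /=.
- by rewrite block_mxEul mxE !ord1 addn0 ?ltnn ?eqxx.
- by rewrite block_mxEur mxE ord1 addn0 ?ltnn ?eqxx ?lt1 ?eq1 ?sub1.
- by rewrite block_mxEdl !mxE ord1 addn0 ?ltnn ?eqxx ?lt1 ?eq1 ?sub1.
- by rewrite block_mxEdr mxE ?lt1 ?eq1 ?lt1 ?eq1.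
Qed.

Lemma pf_minor_natmx (S : comNzRingType) N (A : nat -> nat -> S) (j : 'I_N) :
  pf_minor (natmx N N A) j = natpf N.-1 (fun u v => A (bump j u) (bump j v)).
Proof.
rewrite -pf_natmx; congr pf.
by apply/matrixP => u v; rewrite !mxE.
Qed.

(** Deleting the middle or one of the last s vertices leaves the first s as an edgeless class;
    deleting one of the first s leaves the last s as one. *)
Lemma pf_minor_Vmx n (j : 'I_(n.+1 + (1 + n.+1))) :
  (forall u v, (u < n.+1)%N -> (v < n.+1)%N -> Vent n.+1 (bump j u) (bump j v) = 0) \/
  (forall u v, (n.+1 <= u)%N -> (n.+1 <= v)%N -> Vent n.+1 (bump j u) (bump j v) = 0) ->
  eq_sign (pf_minor (Vmx k n.+1) j)
    (\det (natmx n.+1 n.+1 (fun u v => Vent n.+1 (bump j u) (bump j (n.+1 + v))))).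
Proof.
move=> H; rewrite VmxE pf_minor_natmx.
rewrite (_ : (_).-1 = n.+1 + n.+1)%N; last by rewrite add1n addnS.
by rewrite natpf_bipartite //; apply: eq_sign_signl.
Qed.

Lemma pf_minor_mid n : eq_sign (pf_minor (Vmx k n.+1) (mid n.+1)) (C n.+2).
Proof.
have Em : mid n.+1 = n.+1 :> nat by rewrite /mid /= addn0.
apply: eq_sign_trans (pf_minor_Vmx _) _; rewrite Em.
  left=> u v hu hv; rewrite /Vent /bump.
  have -> : (n.+1 <= u)%N = false by lia.
  have -> : (n.+1 <= v)%N = false by lia.
  by rewrite !add0n hu hv.
apply: eq_sign_trans (det_Umx k n.+1); rewrite UmxE -det_tr.
rewrite (_ : _^T = natmx n.+1 n.+1 (Uent k n.+1)); first exact: eq_sign_refl.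
apply/matrixP => u v; rewrite !mxE /Vent /bump.
have -> : (n.+1 <= v)%N = false by have := ltn_ord v; lia.
have -> : (n.+1 <= n.+1 + u)%N by lia.
rewrite add0n add1n ltn_ord.
have -> : ((n.+1 + u).+1 < n.+1)%N = false by lia.
have -> : ((n.+1 + u).+1 == n.+1)%N = false by lia.
by have -> : ((n.+1 + u).+1 - n.+2 = u)%N by lia.
Qed.

(** The middle vertex moves into the first class, as a last row with single entry y; the
    complementary minor belongs to the first column of the adjugate of U. *)
Lemma pf_minor_first n (i : 'I_n.+1) :
  eq_sign (pf_minor (Vmx k n.+1) (lshift _ i)) (y ^+ (n.+1 - i) * C i.+1).
Proof.
have hi := ltn_ord i.
have hb w : (n.+1 <= w)%N -> (bump i w < n.+1)%N = false /\ (bump i w == n.+1)%N = false.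
  by rewrite /bump; lia.
apply: eq_sign_trans (pf_minor_Vmx _) _; rewrite /=.
  right=> u v /hb[hu hu'] /hb[hv hv']; by rewrite /Vent hu hu' hv hv'.
set M := natmx _ _ _.
have HM : row ord_max M = y *: delta_mx 0 ord0.
  apply/rowP => v; rewrite !mxE /= /Vent /bump.
  have -> : (i <= n)%N by lia.
  have -> : (i <= n.+1 + v)%N by lia.
  rewrite !add1n ltnn eqxx.
  have -> : ((n.+1 + v).+1 < n.+1)%N = false by lia.
  have -> : ((n.+1 + v).+1 == n.+1)%N = false by lia.
  have -> : ((n.+1 + v).+1 - n.+2 = v)%N by lia.
  rewrite -[v == ord0]/(v == 0%N :> nat).
  by case: eqP; rewrite ?mulr1 ?mulr0.
rewrite (expand_det_row _ ord_max) (bigD1 ord0) //= big1 ?addr0; last first.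
  move=> v hv; have /rowP /(_ v) := HM; rewrite mxE => ->.
  by rewrite !mxE (negPf hv) mulr0 mul0r.
have /rowP /(_ ord0) := HM; rewrite mxE => ->; rewrite !mxE /= mulr1.
rewrite subSn // exprS -mulrA; apply: eq_signM; first exact: eq_sign_refl.
apply: eq_sign_trans (adj_Umx_first k i); rewrite mxE.
rewrite /cofactor; apply: eq_signM.
  by exists (n + i)%N; rewrite !exprD; set e := (-1) ^+ n; set f := (-1) ^+ i;
   rewrite expr0 mulr1 mul1r -mulrA -expr2 sqrr_sign mulr1.
rewrite -det_tr (_ : _^T = row' ord0 (col' i (Umx k n.+1))); first exact: eq_sign_refl.
apply/matrixP => u v; rewrite UmxE !mxE /=.
have hu : (u < n)%N by have := ltn_ord u.
have hv : (v < n)%N by have := ltn_ord v.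
have -> : bump n v = v by rewrite /bump; lia.
rewrite /Vent.
have -> : (bump i v < n.+1)%N by rewrite /bump; lia.
have -> : bump i (n.+1 + bump 0 u) = (n.+1 + u).+2 by rewrite /bump; lia.
have -> : ((n.+1 + u).+2 < n.+1)%N = false by lia.
have -> : ((n.+1 + u).+2 == n.+1)%N = false by lia.
by have -> : ((n.+1 + u).+2 - n.+2 = bump 0 u)%N by rewrite /bump; lia.
Qed.

(** The middle vertex is now in the second class, as a first column with single entry x^2; the
    complementary minor belongs to the last row of the adjugate of U. *)
Lemma pf_minor_last n (i : 'I_n.+1) :
  eq_sign (pf_minor (Vmx k n.+1) (rshift _ (rshift _ i))) (x ^+ i.+2 * C (n.+1 - i)).
Proof.
apply: eq_sign_trans (pf_minor_Vmx _) _; rewrite /=.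
  left=> u v hu hv; rewrite /Vent /bump.
  have -> : (n.+1 + (1 + i) <= u)%N = false by lia.
  have -> : (n.+1 + (1 + i) <= v)%N = false by lia.
  by rewrite !add0n hu hv.
set M := natmx _ _ _.
have hi := ltn_ord i.
have HM : col ord0 M = x ^+ 2 *: delta_mx ord_max 0.
  apply/colP => u; rewrite !mxE /= /Vent /bump; have hu := ltn_ord u.
  have -> : (n.+1 + (1 + i) <= u)%N = false by lia.
  have -> : (n.+1 + (1 + i) <= n.+1 + 0)%N = false by lia.
  rewrite !add0n addn0 ltnn eqxx hu andbT eqSS -[u == ord_max]/(u == n :> nat).
  by case: eqP; rewrite ?mulr1 ?mulr0.
rewrite (expand_det_col _ ord0) (bigD1 ord_max) //= big1 ?addr0; last first.
  move=> u hu; have /colP /(_ u) := HM; rewrite mxE => ->.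
  by rewrite !mxE (negPf hu) mulr0 mul0r.
have /colP /(_ ord_max) := HM; rewrite mxE => ->; rewrite !mxE eqxx /= mulr1.
have -> : x ^+ i.+2 = x ^+ 2 * x ^+ i by rewrite -exprD.
rewrite -mulrA; apply: eq_signM; first exact: eq_sign_refl.
apply: eq_sign_trans (adj_Umx_last k i); rewrite mxE.
rewrite /cofactor; apply: eq_signM.
  by exists i; rewrite addn0 exprD mulrA -expr2 sqrr_sign mul1r.
rewrite -det_tr (_ : _^T = row' i (col' ord_max (Umx k n.+1))); first exact: eq_sign_refl.
apply/matrixP => u v; rewrite UmxE !mxE /=.
have hu : (u < n)%N by have := ltn_ord u.
have hv : (v < n)%N by have := ltn_ord v.
have -> : bump n v = v by rewrite /bump; lia.
rewrite /Vent.
have -> : bump (n.+1 + (1 + i)) v = v by rewrite /bump; lia.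
have -> : bump (n.+1 + (1 + i)) (n.+1 + bump 0 u) = (n.+2 + bump i u)%N.
  by rewrite /bump; lia.
have -> : (v < n.+1)%N by lia.
have -> : (n.+2 + bump i u < n.+1)%N = false by lia.
have -> : (n.+2 + bump i u == n.+1)%N = false by lia.
by rewrite addKn.
Qed.

End MinorsV.

(** * The ideal and its quotient *)

Section IdealGen.
Import GRing.Theory.
Local Open Scope ring_scope.
Variable k : fieldType.
Local Notation R := {mpoly k[3]}.

Lemma ideal_gen_mem (G : R -> Prop) g : G g -> ideal_gen G g.
Proof.
move=> Gg; exists 1%N, (fun=> 1), (fun=> g); split=> //.
by rewrite big_ord1 mul1r.
Qed.

Lemma ideal_gen0 (G : R -> Prop) : ideal_gen G 0.
Proof.
exists 0%N, (fun=> 0), (fun=> 0); split; first by case.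
by rewrite big_ord0.
Qed.

Lemma ideal_genD (G : R -> Prop) p q : ideal_gen G p -> ideal_gen G q -> ideal_gen G (p + q).
Proof.
move=> [a [c [g [Hg ->]]]] [b [c' [g' [Hg' ->]]]].
pose pick (T : Type) (f : 'I_a -> T) (f' : 'I_b -> T) i :=
  match split i with inl j => f j | inr j => f' j end.
exists (a + b)%N, (pick _ c c'), (pick _ g g'); split.
  by move=> i; rewrite /pick; case: split.
rewrite big_split_ord /=; congr (_ + _); apply: eq_bigr => i _; rewrite /pick.
  by rewrite (unsplitK (inl _ i)).
by rewrite (unsplitK (inr _ i)).
Qed.

Lemma ideal_genM (G : R -> Prop) r p : ideal_gen G p -> ideal_gen G (r * p).
Proof.
move=> [a [c [g [Hg ->]]]]; exists a, (fun i => r * c i), g; split=> //.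
by rewrite big_distrr /=; apply: eq_bigr => i _; rewrite mulrA.
Qed.

Lemma R_plus_var i : R_plus ('X_i : R).
Proof. by apply: ideal_gen_mem; exists i. Qed.

Lemma R_plus_coeff0 (p : R) : p@_0 = 0 -> R_plus p.
Proof.
move=> H; rewrite [p]mpolyE big_seq_cond.
elim/big_rec: _ => [|m q /andP[hm _] Hq]; first exact: ideal_gen0.
apply: ideal_genD => //; rewrite -mul_mpolyC; apply: ideal_genM.
have : m != 0%MM by apply: contraTneq hm => ->; rewrite mcoeff_msupp H eqxx.
rewrite -mdeg_eq0 mdegE sum_nat_eq0 => /forallPn[i]; rewrite -lep1mP => hi.
by rewrite -(submK hi) mpolyXD; apply: ideal_genM; apply: R_plus_var.
Qed.

Lemma R_plus_homog d (p : R) : (0 < d)%N -> p \is d.-homog -> R_plus p.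
Proof.
move=> hd hp; apply: R_plus_coeff0; apply: (dhomog_nemf_coeff hp).
by rewrite /= mdeg0 eq_sym -lt0n.
Qed.

End IdealGen.

(** * I as a span of basis elements and its generators *)

Section IdealI.
Import GRing.Theory.
Local Open Scope ring_scope.
Variables (k : fieldType) (n : nat).
Local Notation R := {mpoly k[3]}.
Local Notation x := (xv k).
Local Notation y := (yv k).
Local Notation z := (zv k).
Local Notation C := (cheb x y z).
Local Notation gn := (gen x y z n).
Local Notation i0 := (@Ordinal 3 0 isT).
Local Notation i1 := (@Ordinal 3 1 isT).
Local Notation i2 := (@Ordinal 3 2 isT).

Definition in_exp (m : 'X_{1..3}) : bool :=
  (n.+1 < m i0 + m i2)%N || (0 < m i1)%N && (n.+1 <= m i1 + m i2)%N.

Definition coord_ideal (p : R) : Prop := supp_in in_exp (cheb_coord p).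

Lemma coord_ideal0 : coord_ideal 0.
Proof. by rewrite /coord_ideal linear0; apply: supp_in0. Qed.

Lemma coord_idealD p q : coord_ideal p -> coord_ideal q -> coord_ideal (p + q).
Proof. by rewrite /coord_ideal linearD; apply: supp_inD. Qed.

Lemma coord_idealZ c p : coord_ideal p -> coord_ideal (c *: p).
Proof. by rewrite /coord_ideal linearZ; apply: supp_inZ. Qed.

Lemma in_exp_add (i : 'I_3) m : in_exp m -> in_exp (U_(i) + m)%MM.
Proof.
rewrite /in_exp !mnmDE !mnm1E.
case: i => [[|[|[|//]]] hi]; rewrite -!(inj_eq val_inj) /=; lia.
Qed.

Lemma supp_in_zmul (Q Q' : 'X_{1..3} -> bool) (q : R) :
  (forall m, Q m -> Q' (U_(i2) + m)%MM) ->
  (forall m, Q m -> (0 < m i2)%N -> Q' (U_(i0) + U_(i1) + (m - U_(i2)))%MM) ->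
  supp_in Q q -> supp_in Q' (zmul q).
Proof.
move=> H1 H2; apply: supp_in_lin_ext => m Hm; apply: supp_inD.
  by apply/supp_inX/H1.
case: ltnP => hm; last exact: supp_in0.
exact/supp_inX/H2.
Qed.

(** For z, passing from (a, b, j) to (a + 1, b + 1, j - 1) preserves a + j and b + j and makes b
    positive, so it does not leave [in_exp]. *)
Lemma coord_ideal_var (i : 'I_3) p : coord_ideal p -> coord_ideal ('X_i * p).
Proof.
rewrite /coord_ideal; case: i => [[|[|[|//]]] hi] Hp.
- rewrite (_ : 'X__ = x) ?cheb_coord_x; last by congr 'X_(_); apply/val_inj.
  by apply: supp_inXM Hp => m; apply: in_exp_add.
- rewrite (_ : 'X__ = y) ?cheb_coord_y; last by congr 'X_(_); apply/val_inj.
  by apply: supp_inXM Hp => m; apply: in_exp_add.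
- rewrite (_ : 'X__ = z) ?cheb_coord_z; last by congr 'X_(_); apply/val_inj.
  apply: supp_in_zmul Hp => m; first exact: in_exp_add.
  by rewrite /in_exp !(mnmDE, mnmBE, mnm1E) /=; lia.
Qed.

Lemma coord_idealX m p : coord_ideal p -> coord_ideal ('X_[m] * p).
Proof.
rewrite [m]multinomUE_id => Hp.
elim/big_rec: _ p Hp => [|i m' _ IH] p Hp; first by rewrite mpolyX0 mul1r.
rewrite mpolyXD -mulrA; move: (IH _ Hp) => {IH}.
elim: (m i) => [|l IHl] H; first by rewrite mulm0n mpolyX0 mul1r.
by rewrite mulmS mpolyXD -mulrA; apply/coord_ideal_var/IHl.
Qed.

Lemma coord_idealM r p : coord_ideal p -> coord_ideal (r * p).
Proof.
move=> Hp; elim/mpolyind: r => [|c m r _ _ IHr]; first by rewrite mul0r; apply: coord_ideal0.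
rewrite mulrDl -scalerAl; apply: coord_idealD => //.
exact/coord_idealZ/coord_idealX.
Qed.

Lemma coord_ideal_sign p q : eq_sign p q -> coord_ideal q -> coord_ideal p.
Proof. by move=> [b ->]; apply: coord_idealM. Qed.

Lemma coord_ideal_cheb a b j : in_exp (mnm3 a b j) -> coord_ideal (x ^+ a * y ^+ b * C j.+1).
Proof.
rewrite /coord_ideal cheb_coord_xy cheb_coord_cheb => H.
have -> : x ^+ a * y ^+ b * z ^+ j = 'X_[mnm3 a b j] by rewrite mpolyX3 !mnm3E.
exact/supp_inX.
Qed.

Lemma Iss_coord p : Iss k n.+1 p -> coord_ideal p.
Proof.
move=> [q [r [[l [c [g [Hg ->]]]] [t [l' [c' [g' [Hg' ->]]]] ->] ->]]].
apply: coord_idealD.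
  elim/big_rec: _ => [|i w _ IH]; first exact: coord_ideal0.
  apply: coord_idealD => //; apply: coord_idealM.
  have [j hj ->] := Hg i.
  case: (split_ordP j) hj => {}j -> hj.
    apply: coord_ideal_sign (pf_minor_first _ _) _.
    rewrite -[X in coord_ideal (X * _)]mul1r -(expr0 x).
    by apply: coord_ideal_cheb; rewrite /in_exp !mnm3E; have := ltn_ord j; lia.
  case: (split_ordP j) hj => {}j -> hj.
    by move: hj; rewrite ord1 eqxx.
  apply: coord_ideal_sign (pf_minor_last _ _) _.
  have hj' := ltn_ord j; have -> : (n.+1 - j = (n - j).+1)%N by lia.
  rewrite -[X in coord_ideal (X * _)]mulr1 -(expr0 y).
  by apply: coord_ideal_cheb; rewrite /in_exp !mnm3E; lia.
rewrite big_distrl /=.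
elim/big_rec: _ => [|i w _ IH]; first exact: coord_ideal0.
apply: coord_idealD => //; rewrite -mulrA; apply: coord_idealM.
have [b ->] := pf_minor_mid k n; rewrite mulrCA; apply: coord_idealM.
have [v ->] := Hg' i; rewrite /coord_ideal.
case: v => [[|[|[|//]]] hv].
- rewrite (_ : 'X__ = x); last by congr 'X_(_); apply/val_inj.
  have -> : x * C n.+2 = x ^+ 1 * y ^+ 0 * C n.+2 by rewrite expr1 expr0 mulr1.
  by apply: coord_ideal_cheb; rewrite /in_exp !mnm3E; lia.
- rewrite (_ : 'X__ = y); last by congr 'X_(_); apply/val_inj.
  have -> : y * C n.+2 = x ^+ 0 * y ^+ 1 * C n.+2 by rewrite expr1 expr0 mul1r.
  by apply: coord_ideal_cheb; rewrite /in_exp !mnm3E; lia.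
- rewrite (_ : 'X__ = z) ?cheb_coord_z ?cheb_coord_cheb; last by congr 'X_(_); apply/val_inj.
  have := zmulX k 0 0 n; rewrite !expr0 !mul1r !expr1 => ->.
  apply: supp_inD.
    have -> : z ^+ n.+2 = 'X_[mnm3 0 0 n.+2] by rewrite mpolyX3 !mnm3E !mul1r.
    by apply/supp_inX; rewrite /in_exp !mnm3E; lia.
  have -> : x * y * z ^+ n = 'X_[mnm3 1 1 n] by rewrite mpolyX3 !mnm3E !expr1.
  by apply/supp_inX; rewrite /in_exp !mnm3E; lia.
Qed.

Definition gen_span (p : R) : Prop :=
  exists w : nat -> R, p = \sum_(0 <= v < n.+1 + n.+3) w v * gn v.

Lemma gen_spanD p q : gen_span p -> gen_span q -> gen_span (p + q).
Proof.
move=> [w ->] [w' ->]; exists (fun v => w v + w' v).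
by rewrite -big_split; apply: eq_bigr => v _; rewrite mulrDl.
Qed.

Lemma gen_spanM r p : gen_span p -> gen_span (r * p).
Proof.
move=> [w ->]; exists (fun v => r * w v).
by rewrite big_distrr /=; apply: eq_bigr => v _; rewrite mulrA.
Qed.

Lemma gen_span_gen v : (v < n.+1 + n.+3)%N -> gen_span (gn v).
Proof.
move=> hv; exists (fun u => (u == v)%:R).
have := @sum_nat_delta _ (n.+1 + n.+3) gn 1 v; rewrite hv mul1r => <-.
by apply: eq_bigr => u _; rewrite mul1r mulrC.
Qed.

Lemma gen_span_f j : (j <= n)%N -> gen_span (y ^+ (n.+1 - j) * C j.+1).
Proof. by move=> hj; rewrite -gen_f //; apply: gen_span_gen; lia. Qed.

Lemma gen_span_g j : (j <= n.+2)%N -> gen_span (x ^+ (n.+2 - j) * C j.+1).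
Proof. by move=> hj; rewrite -gen_g //; apply: gen_span_gen; lia. Qed.

(** Unlike x D_s = g_s, the element y D_s is not on the list: it equals z f_(s-1) - x f_(s-2), with
    D_(-1) = 0 covering s = 1. *)
Lemma gen_span_yC : gen_span (y * C n.+2).
Proof.
have -> : y * C n.+2 = z * (y ^+ (n.+1 - n) * C n.+1) + (- x) * (y ^+ 2 * C n).
  by rewrite chebSS subSnn; ring.
apply: gen_spanD; apply: gen_spanM; first exact: gen_span_f.
have := @gen_span_f n.-1 (leq_pred n).
case: (n) => [_|l]; last by rewrite /= (_ : l.+2 - l = 2)%N //; lia.
rewrite cheb0 mulr0; exists (fun=> 0).
by rewrite big1 // => v _; rewrite mul0r.
Qed.

(** The recurrence propagates membership from g_(s+1) = D_(s+1) and g_s = x D_s. *)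
Lemma gen_span_C j : (n.+2 <= j)%N -> gen_span (C j.+1).
Proof.
elim/ltn_ind: j => j IHj; rewrite leq_eqVlt => /orP[/eqP <-|hj].
  by have := @gen_span_g n.+2 (leqnn _); rewrite subnn mul1r.
case: j hj IHj => [|[|j]] // hj IHj.
have -> : C j.+3 = z * C j.+2 + (- y) * (x * C j.+1) by rewrite chebSS; ring.
apply: gen_spanD; apply: gen_spanM; first exact: IHj.
have [hj'|hj'] := ltnP j n.+2; last by apply/gen_spanM/IHj.
have -> : j = n.+1 by lia.
by have := @gen_span_g n.+1 (leqnSn _); rewrite subSnn expr1.
Qed.

Lemma gen_span_cheb_mon m : in_exp m -> gen_span (cheb_mon k m).
Proof.
rewrite /in_exp /cheb_mon; set a := m i0; set b := m i1; set j := m i2.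
have [hj _|hj] := ltnP n.+2 j.
  by apply/gen_spanM/gen_span_C/ltnW.
have [ha _|ha /= /andP[hb hbj]] := ltnP n.+1 (a + j).
  have -> : a = (a - (n.+2 - j) + (n.+2 - j))%N by lia.
  rewrite exprD -!mulrA [x ^+ (n.+2 - j) * _]mulrCA; do 2!apply: gen_spanM.
  exact: gen_span_g.
have [hjn|hjn] := leqP j n.
  have -> : b = (b - (n.+1 - j) + (n.+1 - j))%N by lia.
  by rewrite exprD -!mulrA; do 2!apply: gen_spanM; apply: gen_span_f.
have -> : j = n.+1 by lia.
have -> : x ^+ a * y ^+ b * C n.+2 = (x ^+ a * y ^+ b.-1) * (y * C n.+2).
  by rewrite -{1}(prednK hb) exprS; ring.
exact/gen_spanM/gen_span_yC.
Qed.

Lemma coord_ideal_span p : coord_ideal p -> gen_span p.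
Proof.
move=> Hp; rewrite [p]cheb_mon_sum big_seq_cond.
elim/big_rec: _ => [|m q /andP[hm _] Hq].
  by exists (fun=> 0); rewrite big1 // => v _; rewrite mul0r.
apply: gen_spanD => //; rewrite -mul_mpolyC; apply/gen_spanM/gen_span_cheb_mon.
exact: Hp.
Qed.

Lemma IssD p q : Iss k n.+1 p -> Iss k n.+1 q -> Iss k n.+1 (p + q).
Proof.
move=> [a [b [Ha [t Ht ->] ->]]] [a' [b' [Ha' [t' Ht' ->] ->]]].
exists (a + a'), ((t + t') * pf_minor (Vmx k n.+1) (mid n.+1)); split.
- exact: ideal_genD.
- by exists (t + t') => //; apply: ideal_genD.
- by ring.
Qed.

Lemma IssM r p : Iss k n.+1 p -> Iss k n.+1 (r * p).
Proof.
move=> [a [b [Ha [t Ht ->] ->]]].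
exists (r * a), (r * t * pf_minor (Vmx k n.+1) (mid n.+1)); split.
- exact: ideal_genM.
- by exists (r * t) => //; apply: ideal_genM.
- by ring.
Qed.

Lemma Iss_minor j : j != mid n.+1 -> Iss k n.+1 (pf_minor (Vmx k n.+1) j).
Proof.
move=> hj; exists (pf_minor (Vmx k n.+1) j), 0; split; last by rewrite addr0.
  by apply: ideal_gen_mem; exists j.
by exists 0; rewrite ?mul0r //; apply: ideal_gen0.
Qed.

Lemma Iss_mid i : Iss k n.+1 ('X_i * C n.+2).
Proof.
have [b ->] := eq_sign_sym (pf_minor_mid k n); rewrite mulrCA; apply: IssM.
exists 0, ('X_i * pf_minor (Vmx k n.+1) (mid n.+1)); split.
- exact: ideal_gen0.
- by exists 'X_i => //; apply: R_plus_var.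
- by rewrite add0r.
Qed.

Lemma Iss_gen v : (v < n.+1 + n.+3)%N -> Iss k n.+1 (gn v).
Proof.
have Hf (i : 'I_n.+1) : Iss k n.+1 (y ^+ (n.+1 - i) * C i.+1).
  have [b ->] := eq_sign_sym (pf_minor_first k i); apply/IssM/Iss_minor.
  by rewrite /mid eq_lrshift.
move=> hv; have [hvn|hvn] := ltnP v n.+1.
  by rewrite gen_f //; exact: (Hf (Ordinal hvn)).
have [j -> hj] : exists2 j, v = (n.+1 + j)%N & (j < n.+3)%N.
  by exists (v - n.+1)%N; lia.
rewrite gen_g.
have [hjn|hjn] := leqP j n.
  (* The last block lists the g_j in reverse order: its index i gives g_(n-i). *)
  have hi : (n - j < n.+1)%N by lia.
  have -> : x ^+ (n.+2 - j) * C j.+1 = x ^+ (n - j).+2 * C (n.+1 - (n - j)).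
    by congr (_ ^+ _ * C _); lia.
  have [b H] := eq_sign_sym (pf_minor_last k (Ordinal hi)).
  rewrite H; apply/IssM/Iss_minor.
  by rewrite /mid (inj_eq (@rshift_inj _ _)) eq_rlshift.
have [->|->] : j = n.+1 \/ j = n.+2 by lia.
  by rewrite subSnn expr1; apply: Iss_mid.
(* D_(s+1) = z D_s - x y D_(s-1), where y D_(s-1) = f_(s-1). *)
rewrite subnn mul1r chebSS; apply: IssD; first exact: Iss_mid.
rewrite -mulrA -mulrN -mulN1r mulrCA -mulN1r; do 2!apply: IssM.
by have := Hf ord_max; rewrite subSnn expr1.
Qed.

Lemma IssP p : Iss k n.+1 p <-> coord_ideal p.
Proof.
split=> [|/coord_ideal_span [w ->]]; first exact: Iss_coord.
rewrite big_nat; elim/big_rec: _ => [|v q hv Hq].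
  by have := IssM 0 (Iss_mid i0); rewrite mul0r.
by apply: IssD => //; apply/IssM/Iss_gen.
Qed.

Lemma Iss_span p : Iss k n.+1 p <-> gen_span p.
Proof.
split=> [/IssP/coord_ideal_span //|[w ->]].
rewrite big_nat; elim/big_rec: _ => [|v q hv Hq].
  by have := IssM 0 (Iss_mid i0); rewrite mul0r.
by apply: IssD => //; apply/IssM/Iss_gen.
Qed.

End IdealI.

(** * Minimality of the generators, socle and standard monomials *)

Section Quotient.
Import GRing.Theory.
Local Open Scope ring_scope.
Variables (k : fieldType) (n : nat).
Local Notation R := {mpoly k[3]}.
Local Notation x := (xv k).
Local Notation y := (yv k).
Local Notation z := (zv k).
Local Notation C := (cheb x y z).
Local Notation gn := (gen x y z n).
Local Notation i0 := (@Ordinal 3 0 isT).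
Local Notation i1 := (@Ordinal 3 1 isT).
Local Notation i2 := (@Ordinal 3 2 isT).

Lemma in_exp3 a b j : in_exp n (mnm3 a b j) =
  (n.+1 < a + j)%N || (0 < b)%N && (n.+1 <= b + j)%N.
Proof. by rewrite /in_exp !mnm3E. Qed.

Definition gen_exp (u : nat) : 'X_{1..3} :=
  if (u < n.+1)%N then mnm3 0 (n.+1 - u) u else mnm3 (n.+2 - (u - n.+1)) 0 (u - n.+1).

Lemma coord_gen u : (u < n.+1 + n.+3)%N -> cheb_coord (gn u) = 'X_[gen_exp u].
Proof.
move=> hu; rewrite /gen /gen_exp mpolyX3; case: ifP => _; rewrite !mnm3E.
  by rewrite -[X in X * _]mul1r -(expr0 x) cheb_coord_xy cheb_coord_cheb.
by rewrite -[X in X * _]mulr1 -(expr0 y) cheb_coord_xy cheb_coord_cheb.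
Qed.

Definition is_gen_exp (m : 'X_{1..3}) : bool :=
  (m i0 == 0%N) && (0 < m i1)%N && (m i1 + m i2 == n.+1)%N
  || (m i1 == 0%N) && (m i0 + m i2 == n.+2)%N.

Lemma gen_expP u : (u < n.+1 + n.+3)%N -> is_gen_exp (gen_exp u).
Proof.
by move=> hu; rewrite /gen_exp; case: ifP => h; rewrite /is_gen_exp !mnm3E; lia.
Qed.

Lemma gen_exp_inj u v : (u < n.+1 + n.+3)%N -> (v < n.+1 + n.+3)%N ->
  gen_exp u = gen_exp v -> u = v.
Proof.
move=> hu hv H.
have := congr1 (fun m : 'X_{1..3} => m i1) H.
have := congr1 (fun m : 'X_{1..3} => m i2) H.
by rewrite /gen_exp; case: ifP => h; case: ifP => h'; rewrite !mnm3E; lia.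
Qed.

(* The exponents of the generators do not occur in the coordinates of the
   elements of [R_+ I]: this bounds the number of generators from below. *)
Definition in_exp_nongen m := in_exp n m && ~~ is_gen_exp m.

Lemma coord_var_mul (i : 'I_3) (p : R) : coord_ideal n p ->
  supp_in in_exp_nongen (cheb_coord ('X_i * p)).
Proof.
rewrite /coord_ideal; case: i => [[|[|[|//]]] hi] Hp.
- rewrite (_ : 'X__ = x) ?cheb_coord_x; last by congr 'X_(_); apply/val_inj.
  apply: supp_inXM Hp => m; rewrite /in_exp_nongen /in_exp /is_gen_exp !mnmDE !mnm1E /=; lia.
- rewrite (_ : 'X__ = y) ?cheb_coord_y; last by congr 'X_(_); apply/val_inj.
  apply: supp_inXM Hp => m; rewrite /in_exp_nongen /in_exp /is_gen_exp !mnmDE !mnm1E /=; lia.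
- rewrite (_ : 'X__ = z) ?cheb_coord_z; last by congr 'X_(_); apply/val_inj.
  apply: supp_in_zmul Hp => m;
    rewrite /in_exp_nongen /in_exp /is_gen_exp !(mnmDE, mnmBE, mnm1E) /=; lia.
Qed.

(** Modulo R_+ I, multiplication by c is multiplication by its constant term. *)
Lemma coord_mul_const (c p : R) : coord_ideal n p ->
  supp_in in_exp_nongen (cheb_coord (c * p - c@_0 *: p)).
Proof.
move=> Hp; elim/mpolyind: c => [|a m q _ _ IHq].
  by rewrite mul0r mcoeff0 scale0r subr0 linear0; apply: supp_in0.
have -> : (a *: 'X_[m] + q) * p - (a *: 'X_[m] + q)@_0 *: p =
   a *: ('X_[m] * p - ('X_[m] : R)@_0 *: p) + (q * p - q@_0 *: p).
  by rewrite mcoeffD mcoeffZ mulrDl -scalerAl scalerDl scalerBr scalerA opprD addrACA.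
rewrite linearD linearZ; apply: supp_inD => //; apply: supp_inZ.
rewrite mcoeffX; have [->|hm] := eqVneq m 0%MM.
  by rewrite mpolyX0 mul1r scale1r subrr linear0; apply: supp_in0.
rewrite scale0r subr0.
have : mdeg m != 0%N by rewrite mdeg_eq0.
rewrite mdegE sum_nat_eq0 => /forallPn[i]; rewrite -lep1mP => hi.
rewrite -(submK hi) addmC mpolyXD -mulrA; apply: coord_var_mul.
exact: coord_idealX.
Qed.

(** The forms [kap v] vanish on R_+ I and are dual to the generators. Writing the generators through
    h therefore factors an identity matrix over k through dimension [size h]. *)
Lemma Iss_gens_lower (h : seq R) :
  (forall p, Iss k n.+1 p <-> ideal_gen (fun q => q \in h) p) ->
  (n.+1 + n.+3 <= size h)%N.
Proof.
move=> Hh.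
have Hin q : q \in h -> coord_ideal n q.
  by move=> hq; apply/IssP/Hh; apply: ideal_gen_mem.
pose kap (v : nat) (p : R) : k := (cheb_coord p)@_(gen_exp v).
have kapM v c q : (v < n.+1 + n.+3)%N -> q \in h -> kap v (c * q) = c@_0 * kap v q.
  move=> hv /Hin hq; apply/eqP; rewrite -subr_eq0; apply/eqP.
  rewrite /kap -mcoeffZ -mcoeffB -linearZ -linearB.
  apply: (supp_in_coeff (@coord_mul_const c _ hq)).
  by rewrite /in_exp_nongen gen_expP // andbF.
have Hex (u : 'I_(n.+1 + n.+3)) : exists a : 'I_(size h) -> k,
    forall v : 'I_(n.+1 + n.+3), kap v (gn u) = \sum_l a l * kap v h`_l.
  have [a [c [g [Hg E]]]] := (Hh (gn u)).1 (Iss_gen k (ltn_ord u)).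
  (* As h may have repetitions, each term is charged to the first position of its element in h. *)
  exists (fun l : 'I_(size h) => \sum_(i < a | index (g i) h == l :> nat) (c i)@_0) => v.
  rewrite E /kap cheb_coord_sum raddf_sum /=.
  under [RHS]eq_bigr do rewrite big_distrl /=.
  rewrite (exchange_big_dep predT) //=; apply: eq_bigr => i _.
  have hi : (index (g i) h < size h)%N by rewrite index_mem.
  rewrite (big_pred1 (Ordinal hi)) /=; last first.
    by move=> l; rewrite [RHS]eq_sym -[RHS]val_eqE.
  by rewrite nth_index //; apply: kapM.
have [a Ha] := fin_all_exists Hex.
apply: (@mulmx1_min k _ _ (\matrix_(u, l) a u l) (\matrix_(l, v) kap v h`_l)).
apply/matrixP => u v; rewrite !mxE.
under eq_bigr do rewrite !mxE.
rewrite -Ha /kap coord_gen // mcoeffX; congr (nat_of_bool _)%:R.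
apply/eqP/eqP => [/(gen_exp_inj (ltn_ord u) (ltn_ord v))|->] // H.
exact: val_inj.
Qed.

Lemma dhomog_gen u : (u < n.+1 + n.+3)%N ->
  gn u \is (if (u < n.+1)%N then n.+1 else n.+2).-homog.
Proof.
move=> hu; apply/dhomog_coord; rewrite coord_gen //; apply/supp_inX.
by rewrite /gen_exp mdeg3; case: ifP => h; rewrite !mnm3E; lia.
Qed.

Lemma Iss_minimally_generated : minimally_generated (Iss k n.+1) (n.+1 + n.+3).
Proof.
split; last exact: Iss_gens_lower.
exists [tuple gn u | u < n.+1 + n.+3]; split.
  move=> i; rewrite tnth_mktuple; eexists; exact: dhomog_gen.
move=> p; rewrite Iss_span; split.
  move=> [w ->]; exists (n.+1 + n.+3)%N, w, (fun u => gn u); split.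
    by move=> i; apply/tnthP; exists i; rewrite tnth_mktuple.
  by rewrite big_mkord.
move=> [a [c [g [Hg ->]]]]; elim/big_rec: _ => [|i q _ Hq].
  by exists (fun=> 0); rewrite big1 // => v _; rewrite mul0r.
apply: gen_spanD => //; apply: gen_spanM.
by have /tnthP[u ->] := Hg i; rewrite tnth_mktuple; apply: gen_span_gen.
Qed.

(** P and I are both spanned by elements x^a y^b D_j, so those in P and not in I give a basis of the
    image of P. The socle, its graded pieces and the Hilbert function are all instances. *)
Lemma is_basis_mod_coord (P : R -> Prop) (Q : pred 'X_{1..3}) (st : seq 'X_{1..3}) :
  uniq st -> (forall m, (m \in st) = Q m && ~~ in_exp n m) ->
  (forall p, P p <-> supp_in Q (cheb_coord p)) ->
  is_basis_mod P (Iss k n.+1) (fun i : 'I_(size st) => cheb_mon k (nth 0%MM st i)).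
Proof.
move=> ust Hst HP; split.
- move=> j; apply/HP; rewrite cheb_coord_cheb_mon; apply/supp_inX.
  by have := mem_nth 0%MM (ltn_ord j); rewrite Hst => /andP[].
- move=> c /IssP; rewrite /coord_ideal cheb_coord_sum => H j.
  have := supp_in_coeff H (m := nth 0%MM st j).
  have /andP[_ hj] : Q (nth 0%MM st j) && ~~ in_exp n (nth 0%MM st j).
    by rewrite -Hst mem_nth.
  move=> /(_ hj); rewrite raddf_sum (bigD1 j) //= cheb_coordZ cheb_coord_cheb_mon.
  rewrite mcoeffZ mcoeffX eqxx mulr1 big1 ?addr0 // => i hi.
  rewrite cheb_coordZ cheb_coord_cheb_mon mcoeffZ mcoeffX nth_uniq //.
  by rewrite -[(i == j :> nat)]/(i == j) (negPf hi) mulr0.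
move=> p /HP Hp; exists (fun j => (cheb_coord p)@_(nth 0%MM st j)).
apply/IssP => m; rewrite mcoeff_msupp; apply: contraNT => hm.
rewrite linearB /= cheb_coord_sum mcoeffB [X in _ - X]raddf_sum /=.
under eq_bigr do rewrite cheb_coordZ cheb_coord_cheb_mon mcoeffZ mcoeffX.
have [hst|hst] := boolP (m \in st); last first.
  rewrite big1 ?subr0; last first.
    move=> i _; rewrite (_ : _ == m = false) ?mulr0 //.
    by apply: contraNF hst => /eqP <-; rewrite mem_nth.
  by apply/eqP/(supp_in_coeff Hp); move: hst; rewrite Hst hm andbT.
have hi : (index m st < size st)%N by rewrite index_mem.
rewrite (bigD1 (Ordinal hi)) //= nth_index // eqxx mulr1 big1 ?addr0 ?subrr // => i hii.
rewrite (_ : _ == m = false) ?mulr0 //; apply: contraNF hii => /eqP hm'.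
by apply/eqP/val_inj; rewrite /= -hm' index_uniq.
Qed.

(** The exponents of D_s and x^s y^(s-1). *)
Definition soc_exp (m : 'X_{1..3}) : bool :=
  (m == mnm3 0 0 n.+1) || (m == mnm3 n.+1 n 0).

Lemma eq_mnm3 m a b j : (m == mnm3 a b j) = (m i0 == a) && (m i1 == b) && (m i2 == j).
Proof.
apply/eqP/idP => [->|/andP[/andP[/eqP h0 /eqP h1] /eqP h2]].
  by rewrite !mnm3E !eqxx.
by apply: mnm3P; rewrite mnm3E.
Qed.

(** A coefficient divisible by x y receives contributions from two basis elements, whose
    cancellation the socle computation must exclude. *)
Lemma mcoeff_zmul (q : R) a b j :
  (zmul q)@_(mnm3 a.+1 b.+1 j) =
  (if j is j'.+1 then q@_(mnm3 a.+1 b.+1 j') else 0) + q@_(mnm3 a b j.+1).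
Proof.
elim/mpolyind: q => [|c m q _ _ IHq].
  by rewrite linear0 mcoeff0; case: j => [|j]; rewrite !mcoeff0 addr0.
rewrite linearP /= mcoeffD mcoeffZ IHq /zmul lin_extX /zmul_mon.
have -> : ('X_[U_(i2) + m] + (if (0 < m i2)%N then 'X_[U_(i0) + U_(i1) + (m - U_(i2))]
    else 0) : R)@_(mnm3 a.+1 b.+1 j) =
    (if j is j'.+1 then ('X_[m] : R)@_(mnm3 a.+1 b.+1 j') else 0)
    + ('X_[m] : R)@_(mnm3 a b j.+1).
  rewrite mcoeffD (fun_if (mcoeff (mnm3 a.+1 b.+1 j))) mcoeff0 !mcoeffX !eq_mnm3.
  rewrite !(mnmDE, mnmBE, mnm1E) /=; congr (_ + _).
    case: j {IHq} => [|j]; last by rewrite mcoeffX eq_mnm3 /=; congr (nat_of_bool _)%:R; lia.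
    by rewrite (_ : _ && _ = false) //; lia.
  case: ltnP => hm; first by congr (nat_of_bool _)%:R; lia.
  by rewrite (_ : _ && _ = false) //; lia.
case: j IHq => [|j] _; rewrite !mcoeffD !mcoeffZ; first by rewrite !add0r.
by rewrite mulrDr addrACA.
Qed.

(** x and y act by translation of exponents, and confine an exponent outside I to [soc_exp] or to a
    + j = s, b + j = s - 1 with j > 0. There z produces x^(a+1) y^(b+1) D_(j-1), which is outside I;
    the only other source of this term is x^(a+1) y^(b+1) D_(j-2), and that one is excluded by x. *)
Lemma socle_coord p : socle_lift (Iss k n.+1) p <->
  supp_in (fun m => in_exp n m || soc_exp m) (cheb_coord p).
Proof.
split=> [H|Hp r].
  have Hi i : coord_ideal n ('X_i * p) by apply/IssP/H/R_plus_var.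
  have /= := Hi i0; rewrite /coord_ideal -/x cheb_coord_x => Hx.
  have /= := Hi i1; rewrite /coord_ideal -/y cheb_coord_y => Hy.
  have /= := Hi i2; rewrite /coord_ideal -/z cheb_coord_z => Hz.
  move: (cheb_coord p) Hx Hy Hz => q Hx Hy Hz {H Hi}.
  have Ex m : q@_m != 0 -> in_exp n (U_(i0) + m)%MM.
    by move=> hm; apply: Hx; rewrite mcoeff_msupp mcoeffXM.
  have Ey m : q@_m != 0 -> in_exp n (U_(i1) + m)%MM.
    by move=> hm; apply: Hy; rewrite mcoeff_msupp mcoeffXM.
  move=> m; rewrite mcoeff_msupp => hm; have [//|hE /=] := boolP (in_exp n m).
  have := Ex _ hm; have := Ey _ hm; move: hE.
  have Em : m = mnm3 (m i0) (m i1) (m i2) by apply: mnm3P; rewrite mnm3E.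
  rewrite /soc_exp !eq_mnm3.
  case Ej : (m i2) => [|j].
    by rewrite /in_exp !mnmDE !mnm1E Ej /=; lia.
  move=> hE hEy hEx.
  have [[h0 [h1 h2]]|[h0 h1]] : (m i0 = 0 /\ (m i1 = 0 /\ j = n) \/
      (m i0 + j = n /\ m i1 + j.+1 = n))%N.
  - move: hE hEy hEx; rewrite /in_exp !mnmDE !mnm1E Ej /= => hE hEy hEx.
    by lia.
  - by lia.
  suff : q@_m = 0 by move/eqP; rewrite (negPf hm).
  have := mcoeff_zmul q (m i0) (m i1) j.
  rewrite (supp_in_coeff Hz); last by rewrite in_exp3; lia.
  rewrite -Ej -Em => ->; case: j Ej h0 h1 {hE hEy hEx} => [|j] Ej h0 h1.
    by rewrite add0r.
  suff -> : q@_(mnm3 (m i0).+1 (m i1).+1 j) = 0 by rewrite add0r.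
  apply/eqP/contraT => /Ex; rewrite /in_exp !mnmDE !mnm1E !mnm3E /=; lia.
have HX i : coord_ideal n ('X_i * p).
  rewrite /coord_ideal; case: i => [[|[|[|//]]] hi].
  - rewrite (_ : 'X__ = x) ?cheb_coord_x; last by congr 'X_(_); apply/val_inj.
    apply: supp_inXM Hp => m; rewrite /soc_exp !eq_mnm3 /in_exp !mnmDE !mnm1E /=; lia.
  - rewrite (_ : 'X__ = y) ?cheb_coord_y; last by congr 'X_(_); apply/val_inj.
    apply: supp_inXM Hp => m; rewrite /soc_exp !eq_mnm3 /in_exp !mnmDE !mnm1E /=; lia.
  - rewrite (_ : 'X__ = z) ?cheb_coord_z; last by congr 'X_(_); apply/val_inj.
    apply: supp_in_zmul Hp => m;
      rewrite /soc_exp !eq_mnm3 /in_exp !(mnmDE, mnmBE, mnm1E) /=; lia.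
move=> [a [c [g [Hg ->]]]]; apply/IssP; rewrite big_distrl /=.
elim/big_rec: _ => [|i q _ Hq]; first exact: coord_ideal0.
apply: coord_idealD => //; have [j ->] := Hg i.
by rewrite -mulrA; apply: coord_idealM.
Qed.

Definition soc_exps : seq 'X_{1..3} := [:: mnm3 0 0 n.+1; mnm3 n.+1 n 0].

Lemma soc_exps_uniq : uniq soc_exps.
Proof. by rewrite /= inE eq_mnm3 !mnm3E. Qed.

Lemma mem_soc_exps m : (m \in soc_exps) = (in_exp n m || soc_exp m) && ~~ in_exp n m.
Proof.
rewrite !inE -/(soc_exp m); case: (boolP (soc_exp m)) => [|_]; last by rewrite orbF andbN.
by rewrite orbT /= => /orP[] /eqP ->; rewrite in_exp3; lia.
Qed.

Lemma Iss_socle_iso : socle_iso (Iss k n.+1) [:: n.+1; (2 * n.+1 - 1)%N].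
Proof.
exists (fun i : 'I_2 => cheb_mon k (nth 0%MM soc_exps i)).
  exact: (is_basis_mod_coord soc_exps_uniq mem_soc_exps socle_coord).
move=> [[|[|//]] hj] /=; apply/dhomog_coord; rewrite cheb_coord_cheb_mon; apply/supp_inX;
  rewrite mdeg3 !mnm3E; lia.
Qed.

(** The two indicators add up to 2 in degree 1 when s = 1, the case where both socle degrees
    coincide. *)
Lemma Iss_socle_dim l :
  socle_dim (Iss k n.+1) l ((l == n.+1) + (l == 2 * n.+1 - 1))%N.
Proof.
pose st := [seq m <- soc_exps | mdeg m == l].
have -> : ((l == n.+1) + (l == 2 * n.+1 - 1))%N = size st.
  rewrite /st /= !mdeg3 !mnm3E !add0n addn0 (eq_sym l) (eq_sym l).
  have -> : (n.+1 + n = 2 * n.+1 - 1)%N by lia.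
  by case: eqP; case: eqP.
pose Q m := (mdeg m == l) && (in_exp n m || soc_exp m).
exists (fun i : 'I_(size st) => cheb_mon k (nth 0%MM st i)).
apply: (@is_basis_mod_coord _ Q).
- exact/filter_uniq/soc_exps_uniq.
- by move=> m; rewrite mem_filter mem_soc_exps /Q andbA.
move=> p; split=> [[/dhomog_coord h1 /socle_coord h2] m hm|h].
  by rewrite /Q h1 // h2.
by split; [apply/dhomog_coord|apply/socle_coord] => m /h /andP[].
Qed.

(* The exponents (a, b, j) of degree d outside I have b in an interval of this length
   starting at d - s; the last summand counts D_s. *)
Definition std_len (d j : nat) : nat :=
  (minn (n.+1 - j) (d.+1 - j) - (d - n.+1) + ((j == n.+1) && (d == n.+1)))%N.

Definition std_exps (d : nat) : seq 'X_{1..3} :=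
  [seq mnm3 (d - j - b) b j | j <- iota 0 d.+1, b <- iota (d - n.+1) (std_len d j)].

Lemma std_exps_uniq d : uniq (std_exps d).
Proof.
apply: allpairs_uniq_dep; [exact: iota_uniq | by move=> j _; apply: iota_uniq |].
move=> [j b] [j' b'] _ _ /= H.
have := congr1 (fun m : 'X_{1..3} => m i1) H.
have := congr1 (fun m : 'X_{1..3} => m i2) H.
by rewrite !mnm3E => -> ->.
Qed.

Lemma mem_std_exps d m : (m \in std_exps d) = (mdeg m == d) && ~~ in_exp n m.
Proof.
apply/allpairsPdep/idP => [[j [b [hj hb ->]]]|].
  move: hj hb; rewrite !mem_iota mdeg3 in_exp3 !mnm3E /std_len.
  by case: (eqVneq j n.+1) => h1; case: (eqVneq d n.+1) => h2 /=; lia.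
move=> /andP[/eqP <-]; rewrite mdeg3 /in_exp => h.
exists (m i2), (m i1); split; last by apply: mnm3P; rewrite mnm3E //; lia.
  by rewrite mem_iota; lia.
rewrite mem_iota /std_len; move: h.
set a := m i0; set b := m i1; set j := m i2.
by case: (eqVneq j n.+1) => h1; case: (eqVneq (a + b + j)%N n.+1) => h2 /=; lia.
Qed.

Lemma size_std_exps d : size (std_exps d) = (\sum_(0 <= j < d.+1) std_len d j)%N.
Proof.
rewrite size_allpairs_dep sumnE big_map /index_iota subn0.
by apply: eq_bigr => j _; rewrite size_iota.
Qed.

Lemma Iss_quot_dim d : quot_dim (Iss k n.+1) d (size (std_exps d)).
Proof.
exists (fun i : 'I_(size (std_exps d)) => cheb_mon k (nth 0%MM (std_exps d) i)).
apply: (@is_basis_mod_coord _ (fun m => mdeg m == d)).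
- exact: std_exps_uniq.
- exact: mem_std_exps.
- by move=> p; apply: dhomog_coord.
Qed.

End Quotient.

(** * Counting the standard monomials *)

Section Count.

Lemma bin_add2 i : 'C(2 + i, i) = 'C(i.+2, 2).
Proof. by have := @bin_sub (2 + i) 2 (leq_addr _ _); rewrite addKn. Qed.

Lemma sum_subn m : \sum_(0 <= j < m) (m - j) = 'C(m.+1, 2).
Proof.
elim: m => [|m IHm]; first by rewrite big_geq.
rewrite big_nat_recl // subn0 (eq_bigr (fun j => m - j)) => [|j _]; last by rewrite subSS.
by rewrite IHm [RHS]binS bin1 addnC.
Qed.

Lemma sum_delta_cond N d a (f : nat -> nat) : a < N ->
  \sum_(l < N | d <= l) (l == a :> nat) * f l = if d <= a then f a else 0.
Proof.
move=> ha; rewrite big_mkcond (bigD1 (Ordinal ha)) //= eqxx mul1n big1 ?addn0 // => i.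
by rewrite -val_eqE /= => /negPf ->; rewrite mul0n if_same.
Qed.

(** For d < s every exponent is standard and the minimum is the first binomial. For d > s only the
    socle degree 2s - 1 contributes, with 'C(2s - d + 1, 2). At d = s the socle degree s adds 1,
    which counts D_s. *)
Lemma sum_std_len n d : d <= 2 * n.+1 - 1 ->
  \sum_(0 <= j < d.+1) std_len n d j =
  minn 'C(2 + d, d)
    (\sum_(l < (2 * n.+1 - 1).+1 | d <= l)
       ((l == n.+1 :> nat) + (l == 2 * n.+1 - 1 :> nat)) * 'C(2 + (l - d), l - d)).
Proof.
move=> hd; have -> : \sum_(l < (2 * n.+1 - 1).+1 | d <= l)
       ((l == n.+1 :> nat) + (l == 2 * n.+1 - 1 :> nat)) * 'C(2 + (l - d), l - d) =
   (if d <= n.+1 then 'C((n.+1 - d).+2, 2) else 0) + 'C((2 * n.+1 - 1 - d).+2, 2).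
  under eq_bigr do rewrite mulnDl.
  rewrite big_split /= !(sum_delta_cond _ (fun l => 'C(2 + (l - d), l - d))) ?hd; try lia.
  by rewrite !bin_add2.
rewrite bin_add2; have [hdn|hdn|->] := ltngtP d n.+1.
- have -> : \sum_(0 <= j < d.+1) std_len n d j = 'C(d.+2, 2).
    rewrite -sum_subn; apply: eq_big_nat => j hj; rewrite /std_len.
    by rewrite (ltn_eqF hdn) andbF; lia.
  apply/esym/minn_idPl/(leq_trans _ (leq_addl _ _))/leq_bin2l; lia.
- have -> : \sum_(0 <= j < d.+1) std_len n d j = 'C((2 * n.+1 - d).+1, 2).
    rewrite -sum_subn (@big_cat_nat _ _ _ (2 * n.+1 - d)) //=; last by lia.
    rewrite [X in _ + X]big_nat [X in _ + X]big1 ?addn0; last first.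
      by move=> j /andP[hj _]; rewrite /std_len (gtn_eqF hdn) andbF; lia.
    by apply: eq_big_nat => j hj; rewrite /std_len (gtn_eqF hdn) andbF; lia.
  rewrite add0n (_ : (2 * n.+1 - 1 - d).+2 = (2 * n.+1 - d).+1); last by lia.
  apply/esym/minn_idPr/leq_bin2l; lia.
rewrite subnn (_ : (2 * n.+1 - 1 - n.+1).+2 = n.+2); last by lia.
have -> : \sum_(0 <= j < n.+2) std_len n n.+1 j = 1 + 'C(n.+2, 2).
  rewrite big_nat_recr //= addnC /std_len !eqxx -sum_subn; congr (_ + _); first by lia.
  by apply: eq_big_nat => j hj; rewrite ltn_eqF //=; lia.
apply/esym/minn_idPr; rewrite [leqRHS]binS bin1 addnC; apply: leq_add => //.
Qed.

End Count.

(** * Degrees of the entries and the graded resolution *)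

Section ResolutionI.
Import GRing.Theory.
Local Open Scope ring_scope.
Variables (k : fieldType) (n : nat).
Local Notation R := {mpoly k[3]}.
Local Notation x := (xv k).
Local Notation y := (yv k).
Local Notation z := (zv k).
Local Notation C := (cheb x y z).
Local Notation gn := (gen x y z n).
Local Notation sz := (syz x y z n).
Local Notation ssz := (ssyz x y z n).

(** The last clause makes entries of degree 0 vanish, which is what minimality of the resolution
    asks for. *)
Definition homog_entry (e : R) (a b : nat) : Prop :=
  [/\ (b <= a)%N, e \is (a - b)%N.-homog & a = b -> e = 0].

Lemma homog_entry0 a b : (b <= a)%N -> homog_entry 0 a b.
Proof. by move=> h; split=> //; apply: dhomog0. Qed.

Lemma homog_entry_pos d e a b : e \is d.-homog -> (0 < d)%N -> a = (d + b)%N ->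
  homog_entry e a b.
Proof.
by move=> he hd ->; split; rewrite ?leq_addl ?addnK // => h; exfalso; lia.
Qed.

Lemma homog_entryR_plus e a b : homog_entry e a b -> R_plus e.
Proof.
move=> [hab he h0]; have [h|h] := posnP (a - b)%N; last exact: R_plus_homog he.
by rewrite h0; [exact: ideal_gen0 | lia].
Qed.

Lemma dhomog_natb d (e : R) (b : bool) : e \is d.-homog -> e * b%:R \is d.-homog.
Proof. by case: b; rewrite ?mulr1 ?mulr0 // => _; apply: dhomog0. Qed.

Lemma dhomog2 (p q : R) : p \is 1.-homog -> q \is 1.-homog -> p * q \is 2.-homog.
Proof. exact: (@dhomogM _ _ _ 1%N _ 1%N). Qed.

Lemma dhomog_varX i j : ('X_i : R) ^+ j \is j.-homog.
Proof. by have := dhomogMn j (dhomog_var k i); rewrite mul1n. Qed.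

Lemma gen_homog u : (u < n.+1 + n.+3)%N ->
  homog_entry (gn u) (if (u < n.+1)%N then n.+1 else n.+2) 0.
Proof.
move=> hu; apply: homog_entry_pos (dhomog_gen k hu) _ _; last by rewrite addn0.
by case: ifP.
Qed.

Lemma syz_homog u v : (u < n + n.+2 + 3)%N -> (v < n.+1 + n.+3)%N ->
  homog_entry (sz u v) (if (u < n)%N then n.+2 else n.+3)
    (if (v < n.+1)%N then n.+1 else n.+2).
Proof.
move=> hu hv.
have [hx hy hz] : [/\ x \is 1.-homog, y \is 1.-homog & z \is 1.-homog].
  by split; apply: dhomog_var.
rewrite /syz; case: ltnP => hun.
  case: ltnP => hvn.
    apply: (@homog_entry_pos 1) => //; rewrite /syzA.
    by apply: rpredD; first apply: rpredB; apply: dhomog_natb.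
  rewrite /syzA; have -> : (v == u.+1) = false by lia.
  have -> : (v == u) = false by lia.
  have -> : (v.+1 == u) = false by lia.
  by rewrite /= !mulr0 subr0 addr0; apply: homog_entry0.
case: ltnP => hun2.
  case: ltnP => hvn.
    rewrite /syzB; have -> : (v == n.+1 + (u - n).+1)%N = false by lia.
    have -> : (v == n.+1 + (u - n))%N = false by lia.
    have -> : (n < v)%N = false by lia.
    by rewrite /= !mulr0 subr0 addr0; apply: homog_entry0; lia.
  apply: (@homog_entry_pos 1) => //; rewrite /syzB.
  by apply: rpredD; first apply: rpredB; apply: dhomog_natb.
have : (u - (n + n.+2) < 3)%N by lia.
move: (u - _)%N => c hc; case: (ltnP v n.+1) => hvn.
  have [E0 E1 E2] := syzC_f x y z hvn.
  case: c hc => [|[|[|//]]] _; rewrite ?E0 ?E1 ?E2; apply: (@homog_entry_pos 2) => //.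
  - by apply/dhomog_natb/dhomog_varX.
  - by apply: rpredB; apply: dhomog_natb; [apply: dhomog2|apply: dhomog_varX].
  - apply: rpredB; apply: dhomog_natb; last exact: dhomog2.
    by apply: rpredB; [apply: dhomog_varX | apply: dhomog2].
have [i -> _] : exists2 i, v = (n.+1 + i)%N & (i < n.+3)%N.
  by exists (v - n.+1)%N; lia.
have [E0 E1 E2] := syzC_g x y z n i.
case: c hc => [|[|[|//]]] _; rewrite ?E0 ?E1 ?E2; apply: (@homog_entry_pos 1) => //;
  by rewrite rpredN; apply: dhomog_natb.
Qed.

Lemma ssyz_homog t u : (t < 2)%N -> (u < n + n.+2 + 3)%N ->
  homog_entry (ssz t u) (if t == 0%N then n.+4 else (n.+1 + n.+3)%N)
    (if (u < n)%N then n.+2 else n.+3).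
Proof.
move=> ht hu.
have [hx hy hz] : [/\ x \is 1.-homog, y \is 1.-homog & z \is 1.-homog].
  by split; apply: dhomog_var.
rewrite /ssyz; case: t ht => [|[|//]] _ /=.
  case: ltnP => hun; first by apply: homog_entry0; lia.
  case: ltnP => hun2.
    by apply: (@homog_entry_pos 1) => //; apply: dhomog_natb.
  case: (u - _)%N => [|[|l]]; apply: (@homog_entry_pos 1) => //.
  by rewrite rpredN.
case: ltnP => hun.
  apply: (@homog_entry_pos (n.+2 - u + u)); [|lia|lia].
  by rewrite rpredN; apply: dhomogM; [apply: dhomog_varX|apply: dhomog_cheb].
case: ltnP => hun1.
  apply: (@homog_entry_pos (n.+1 - (u - n) + (u - n))); [|lia|lia].
  by apply: dhomogM; [apply: dhomog_varX|apply: dhomog_cheb].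
case: ltnP => hun2; first by apply: homog_entry0; lia.
case: (u - _)%N => [|[|l]]; last by apply: homog_entry0; lia.
  by apply: (@homog_entry_pos n.+1); rewrite ?rpredN ?dhomog_cheb //; lia.
apply: (@homog_entry_pos n.+1); [|lia|lia].
by apply: (@dhomogM _ _ _ 1%N _ n) => //; apply: dhomog_cheb.
Qed.

Definition res_entry (i : nat) : nat -> nat -> R :=
  match i with
  | 0 => fun u _ => gn u
  | 1 => sz
  | 2 => ssz
  | _ => fun _ _ => 0
  end.

Local Notation F := [:: nseq n.+1 n.+1 ++ nseq (n.+1 + 2) (n.+1 + 1);
    nseq (n.+1 - 1) (n.+1 + 1) ++ nseq (n.+1 + 4) (n.+1 + 2);
    [:: n.+1 + 3; 2 * n.+1 + 2]]%N.

Lemma natmx_mul0 l m p (e f : nat -> nat -> R) :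
  (forall u v, (u < l)%N -> (v < p)%N -> \sum_(0 <= j < m) e u j * f j v = 0) ->
  natmx l m e *m natmx m p f = 0.
Proof.
move=> H; apply/matrixP => u v; rewrite !mxE -[RHS](H u v) // big_mkord.
by apply: eq_bigr => j _; rewrite !mxE.
Qed.

Lemma rV_size0 m (w : 'rV[R]_m) : m = 0%N -> w = 0.
Proof. by move=> hm; apply/rowP => -[i hi]; exfalso; rewrite hm in hi. Qed.

Lemma Iss_resolution : has_min_graded_resolution (Iss k n.+1) F.
Proof.
have sF1 : shifts F 1 = (nseq n.+1 n.+1 ++ nseq (n.+1 + 2) (n.+1 + 1))%N by [].
have sF2 : shifts F 2 = (nseq (n.+1 - 1) (n.+1 + 1) ++ nseq (n.+1 + 4) (n.+1 + 2))%N by [].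
have hN1 : free_rk F 1 = (n.+1 + n.+3)%N.
  by rewrite /free_rk sF1 size_cat !size_nseq; lia.
have hN2 : free_rk F 2 = (n + n.+2 + 3)%N.
  by rewrite /free_rk sF2 size_cat !size_nseq; lia.
have hS1 u : nth 0%N (shifts F 1) u =
    if (u < n.+1)%N then n.+1 else if (u < free_rk F 1)%N then n.+2 else 0%N.
  rewrite hN1 sF1 nth_cat !nth_nseq size_nseq; case: ltnP => // h.
  by rewrite addn1; congr (if _ then _ else _); lia.
have hS2 u : nth 0%N (shifts F 2) u =
    if (u < n)%N then n.+2 else if (u < free_rk F 2)%N then n.+3 else 0%N.
  rewrite hN2 sF2 nth_cat !nth_nseq size_nseq subn1 /= addn1 addn2.
  by case: ltnP => // h; congr (if _ then _ else _); lia.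
have regxy (a b : R) : y * a = x * b -> exists c, a = x * c /\ b = y * c.
  exact: mpolyX_regular.
have regyz (a b : R) : z * a = y * b -> exists c, a = y * c.
  move=> H; have [//|c [Hc _]] := mpolyX_regular _ H; by exists c.
have regz (p : R) : in_pow x y n (z * p) -> in_pow x y n p.
  exact: regular_zv.
have Hent i (u : 'I_(free_rk F i.+1)) (v : 'I_(free_rk F i)) :
  homog_entry (res_entry i u v) (nth 0%N (shifts F i.+1) u) (nth 0%N (shifts F i) v).
  case: i u v => [|[|[|i]]] u v.
  - rewrite (_ : nth 0%N (shifts F 0) v = 0%N); last by case: v => -[|[]].
    by rewrite hS1 ltn_ord; apply: gen_homog; rewrite -hN1.
  - by rewrite hS1 hS2 !ltn_ord; apply: syz_homog; rewrite -?hN1 -?hN2.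
  - rewrite hS2 ltn_ord; have := @ssyz_homog u v (ltn_ord u).
    rewrite -hN2 => /(_ (ltn_ord v)).
    suff -> : nth 0%N (shifts F 3) u = (if u == 0%N :> nat then n.+4 else n.+1 + n.+3)%N by [].
    by case: u => -[|[|//]] hu /=; lia.
  - have hu := ltn_ord u; exfalso; move: hu.
    by rewrite {2}/free_rk /shifts /= nth_nil.
exists (fun i => natmx (free_rk F i.+1) (free_rk F i) (res_entry i)); split.
- move=> i u v a b; have [hab he _] := Hent i u v.
  by rewrite mxE; split=> // hba; move: hab; rewrite leqNgt hba.
- move=> p; rewrite Iss_span; split=> [[w Hw]|[w Hw]].
    exists (\row_i w i); apply/rowP => v; rewrite mxE mul_row_natmx ord1 eqxx mulr1n.
    rewrite Hw -hN1 !big_mkord; apply: eq_bigr => i _.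
    by rewrite natrowE mxE.
  have /rowP /(_ 0) := Hw; rewrite mxE mul_row_natmx eqxx mulr1n => ->.
  by exists (natrow w); rewrite -hN1.
- case=> [|[|[|i]]] w.
  + split=> [Hw|[w' ->]].
      have [] := @ker_gen _ x y z n _ _ hN1 hN2 (xv_neq0 k) (yv_neq0 k) regxy regyz regz w.
        by have /rowP /(_ 0) := Hw; rewrite mul_row_natmx mxE.
      by move=> w' ->; exists w'.
    rewrite -mulmxA natmx_mul0 ?mulmx0 // => u v; rewrite hN2 => hu _.
    rewrite -[RHS](syz_gen x y z hu) hN1; apply: eq_bigr => j _.
    by rewrite mulrC.
  + split=> [Hw|[w' ->]].
      exact: (@ker_syz _ x y z n _ _ hN1 hN2 (yv_neq0 k) regxy regyz w Hw).
    rewrite -mulmxA natmx_mul0 ?mulmx0 // => u v _; rewrite hN1 => hv.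
    by rewrite -[RHS](ssyz_syz x y z u hv) hN2.
  + split=> [Hw|[w' ->]].
      exists 0; rewrite mul0mx.
      exact: (@ker_ssyz _ x y z n _ _ hN1 hN2 (xv_neq0 k) (yv_neq0 k) w Hw).
    by rewrite (rV_size0 w') ?mul0mx.
  (* Past the end of the list of shifts [nth] returns the empty list, so the remaining modules have
     rank 0. *)
  + have hi : free_rk F i.+4 = 0%N by rewrite /free_rk /shifts /= nth_nil.
    split=> _; last by rewrite (rV_size0 w hi) mul0mx.
    by exists 0; rewrite mul0mx; apply: rV_size0.
- by move=> i u v; rewrite mxE; apply: homog_entryR_plus (Hent i u v).
Qed.

End ResolutionI.

Theorem proposition7p5 (k : fieldType) (s : nat) (hs : 1 <= s) :
  [/\ minimally_generated (Iss k s) (2 * s + 2),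
      compressed (Iss k s) (2 * s - 1),
      socle_iso (Iss k s) [:: s; 2 * s - 1]
    & has_min_graded_resolution (Iss k s)
        [:: nseq s s ++ nseq (s + 2) (s + 1);
            nseq (s - 1) (s + 1) ++ nseq (s + 4) (s + 2);
            [:: s + 3; 2 * s + 2]] ].
Proof.
case: s hs => [//|n] _; split.
- by rewrite (_ : 2 * n.+1 + 2 = n.+1 + n.+3); [exact: Iss_minimally_generated | lia].
- exists (fun l => (l == n.+1) + (l == 2 * n.+1 - 1)).
    by move=> l _; apply: Iss_socle_dim.
  move=> i hi; have := Iss_quot_dim k n i.
  by rewrite size_std_exps sum_std_len.
- exact: Iss_socle_iso.
- exact: Iss_resolution.
Qed.
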